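(* Let $m\ge2$, let $G\subset\operatorname{Aut}(\mathbb T_m)$ be an automaton group and let $\mu$ be a probability measure on $G$. Suppose that the subgroup generated by the support of $\mu$ acts transitively on every level of the tree $\mathbb T_m$ and that the sequence $(T^k\mu)_{k\ge 0}$ of iterated ascensions of $\mu$ is entropy-tight. Then for every probability measure $\nu$ on $G$ that is a subsequential weak limit of $(T^k\mu)_{k\ge0}$, $$H_\infty(\mu)\le H_\infty(\nu).$$
   Context: $\mathbb T_m$ is the rooted $m$-ary tree of finite words over $\{0,\dots,m-1\}$ (children of $w$ are $wx$; level $n$ is the set of words of length $n$); $\operatorname{Aut}(\mathbb T_m)$ acts on the right, $v\mapsto v.g$. The section of $g$ at a word $v$ is the automorphism $g(v)$ with $(vw).g=(v.g)(w.g(v))$ for all words $w$. An automaton is a finite subset $A\subset \operatorname{Aut}(\mathbb T_m)$ such that $a(x)\in A$ for every $a\in A$ and every letter $x$; an automaton group is a group generated by an automaton. Ascension operator $T$: given a probability measure $\mu$ on $G$, let $X_1,X_2,\dots$ be i.i.d. with law $\mu$, $Z_n=X_1X_2\cdots X_n$, and $\tau=\min\{n\ge1: 0.Z_n=0\}$, where $0$ is the first-level vertex with letter $0$ ($\tau$ is almost surely finite since the stabilizer of $0$ has finite index). Then $T\mu$ is the law of the section $Z_\tau(0)\in G$. $H(\mu)=\sum_x-\mu(x)\log\mu(x)$ (with $0\log0=0$), and $H_\infty(\mu)=\lim_n\frac1nH(\mu^{*n})$ is the asymptotic entropy. A family $\{\mu_i\}$ of probability measures on a countable set is entropy-tight if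 for every $\varepsilon>0$ there is a finite set $K$ with $\sum_{x\notin K}-\mu_i(x)\log\mu_i(x)<\varepsilon$ for all $i$. Weak convergence is with respect to the discrete topology on $G$. *)

(* Defs.v *)
From HB Require Import structures.
From mathcomp Require Import all_boot all_order all_algebra finmap.
From mathcomp Require Import all_classical all_reals all_analysis.

Set Implicit Arguments.
Unset Strict Implicit.
Unset Printing Implicit Defensive.

Import Order.TTheory GRing.Theory Num.Theory.
Import numFieldNormedType.Exports.

Local Open Scope classical_set_scope.
Local Open Scope ring_scope.

(* For a bijection of the words, fixing the root and mapping children of [w]
   to children of [f w] amounts to being an automorphism of the rooted tree. *)
Definition tree_automorphism (m : nat) (f : seq 'I_m -> seq 'I_m) : Prop :=
  [/\ bijective f, f [::] = [::] &
      forall w x, exists y, f (rcons w x) = rcons (f w) y].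

Record aut (m : nat) := Aut {
  act :> seq 'I_m -> seq 'I_m;
  actP : tree_automorphism act }.

HB.instance Definition _ (m : nat) := gen_eqMixin (aut m).
HB.instance Definition _ (m : nat) := gen_choiceMixin (aut m).

Section AutTheory.
Context {m : nat}.
Implicit Types (g h : aut m) (u v w : seq 'I_m).

Lemma aut_ext g h : act g =1 act h -> g = h.
Proof.
case: g h => [f fP] [f' f'P] /= /funext eqf; subst f'.
by congr Aut; exact: Prop_irrelevance.
Qed.

Lemma act_cat g v w : exists2 u, size u = size w & g (v ++ w) = g v ++ u.
Proof.
elim/last_ind: w => [|w x [u su gvw]]; first by exists [::]; rewrite ?cats0.
have [_ _ /(_ (v ++ w) x) [y gy]] := actP g.
exists (rcons u y); first by rewrite !size_rcons su.
by rewrite -rcons_cat gy gvw rcons_cat.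
Qed.

Lemma size_act g w : size (g w) = size w.
Proof.
have [u su] := act_cat g [::] w.
by have [_ -> _] := actP g => /= ->.
Qed.

Fact aut_one_subproof : tree_automorphism (@id (seq 'I_m)).
Proof. by split=> // [|w x]; [exists id | exists x]. Qed.
Definition aut_one := Aut aut_one_subproof.

Fact aut_mul_subproof g h : tree_automorphism (act h \o act g).
Proof.
have [bg g0 gc] := actP g; have [bh h0 hc] := actP h; split => /=.
- exact: bij_comp.
- by rewrite g0.
- by move=> w x; have [y ->] := gc w x; have [z ->] := hc (g w) y; exists z.
Qed.
(* Automorphisms act on the right: [v.(gh) = (v.g).h]. *)
Definition aut_mul g h := Aut (aut_mul_subproof g h).

Fact aut_inv_exists g : exists f, cancel (act g) f /\ cancel f (act g).
Proof. by have [[f gf fg] _ _] := actP g; exists f. Qed.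

Fact aut_inv_subproof g :
  tree_automorphism (projT1 (cid (aut_inv_exists g))).
Proof.
case: cid => f [gf fg] /=; have [_ g0 gc] := actP g; split.
- by exists (act g).
- by rewrite -[in LHS]g0 gf.
- move=> w x; case/lastP E : (f (rcons w x)) => [|p y].
    move: (congr1 (act g) E); rewrite fg g0.
    by move/(congr1 size); rewrite size_rcons.
  exists y; move: (congr1 (act g) E); rewrite fg.
  by have [z ->] := gc p y => /rcons_inj[-> _]; rewrite gf.
Qed.
Definition aut_inv g := Aut (aut_inv_subproof g).

Lemma aut_invK g : cancel (act g) (aut_inv g).
Proof. by rewrite /=; case: cid => f []. Qed.

Lemma aut_Kinv g : cancel (aut_inv g) (act g).
Proof. by rewrite /=; case: cid => f []. Qed.

Fact aut_mulA : associative aut_mul.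
Proof. by move=> g h k; exact: aut_ext. Qed.
Fact aut_mul1 : left_id aut_one aut_mul.
Proof. by move=> g; exact: aut_ext. Qed.
Fact aut_1mul : right_id aut_one aut_mul.
Proof. by move=> g; exact: aut_ext. Qed.
Fact aut_mulV : left_inverse aut_one aut_inv aut_mul.
Proof. by move=> g; apply: aut_ext; exact: aut_Kinv. Qed.
Fact aut_Vmul : right_inverse aut_one aut_inv aut_mul.
Proof. by move=> g; apply: aut_ext; exact: aut_invK. Qed.

HB.instance Definition _ := isGroup.Build (aut m)
  aut_mulA aut_mul1 aut_1mul aut_mulV aut_Vmul.

Lemma actM g h w : (g * h)%g w = h (g w). Proof. by []. Qed.
Lemma act1 w : (1%g : aut m) w = w. Proof. by []. Qed.
Lemma actVK g : cancel (act g) (act g^-1%g). Proof. exact: aut_invK. Qed.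
Lemma actKV g : cancel (act g^-1%g) (act g). Proof. exact: aut_Kinv. Qed.

Definition section_fun g v w := drop (size v) (g (v ++ w)).

Lemma section_funE g v w : g (v ++ w) = g v ++ section_fun g v w.
Proof.
rewrite /section_fun; have [u _ ->] := act_cat g v w.
by rewrite -(size_act g v) drop_size_cat.
Qed.

Fact section_subproof g v : tree_automorphism (section_fun g v).
Proof.
have [_ _ gc] := actP g; split.
- exists (section_fun g^-1%g (g v)) => w; rewrite {1}/section_fun.
    by rewrite -section_funE actVK size_act drop_size_cat.
  have := section_funE g^-1%g (g v) w; rewrite actVK => <-.
  by rewrite actKV -(size_act g v) drop_size_cat.
- by rewrite /section_fun cats0 -(size_act g v) drop_size.
- move=> w x; rewrite {1}/section_fun -rcons_cat.
  have [y ->] := gc (v ++ w) x; exists y.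
  by rewrite section_funE rcons_cat -(size_act g v) drop_size_cat.
Qed.
Definition section g v := Aut (section_subproof g v).

Lemma sectionE g v w : g (v ++ w) = g v ++ section g v w.
Proof. exact: section_funE. Qed.

Lemma section_eq g v h :
  (forall w, g (v ++ w) = g v ++ h w) -> section g v = h.
Proof.
move=> gh; apply: aut_ext => w.
by have /eqP := sectionE g v w; rewrite gh eqseq_cat// eqxx => /eqP.
Qed.

Lemma section1 v : section 1%g v = 1%g. Proof. exact: section_eq. Qed.

Lemma sectionM g h v : section (g * h)%g v = (section g v * section h (g v))%g.
Proof. by apply: section_eq => w; rewrite !actM !sectionE. Qed.

Lemma sectionV g v : section g^-1%g v = (section g (g^-1%g v))^-1%g.
Proof.
apply: section_eq => w; apply: (can_inj (actVK g)).
by rewrite actKV sectionE !actKV.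
Qed.

End AutTheory.

Definition is_subgroup (G : groupType) (H : set G) : Prop :=
  H 1%g /\ forall a b, H a -> H b -> H (a * b^-1)%g.

Definition generated (G : groupType) (A : set G) : set G :=
  smallest (@is_subgroup G) A.

Lemma generated_subgroup (G : groupType) (A : set G) :
  is_subgroup (generated A).
Proof.
split=> [H [[]//]|a b ha hb H [sH AH]].
by apply: sH.2; [exact: ha | exact: hb].
Qed.

Record automaton (m : nat) := Automaton {
  states : set (aut m);
  automaton_finite : finite_set states;
  automaton_closed : forall a x, states a -> states (section a [:: x]) }.

Section AutomatonGroup.
Context {m : nat} (A : automaton m).

Definition autgroup : Type := set_type (generated (states A)).

HB.instance Definition _ := SubChoice.on autgroup.

Fact autgroup_closed :
  group_closed (fun g : aut m => g \in generated (states A)).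
Proof.
have [g1 gV] := generated_subgroup (states A).
split=> [|a b]; rewrite !unfold_in; first exact: (mem_set g1).
by move=> /set_mem ha /set_mem hb; exact: mem_set (gV _ _ _ _).
Qed.

HB.instance Definition _ := SubChoice_isSubGroup.Build (aut m)
  (fun g : aut m => g \in generated (states A)) autgroup autgroup_closed.

HB.instance Definition _ := isPointed.Build autgroup 1%g.

HB.instance Definition _ := @isMeasurable.Build default_measure_display
  autgroup discrete_measurable discrete_measurable0
  discrete_measurableC discrete_measurableU.

Lemma generated_section g x :
  generated (states A) g -> generated (states A) (section g [:: x]).
Proof.
move=> hg; have [g1 gV] := generated_subgroup (states A).
apply: (hg [set h | forall y, generated (states A) (section h [:: y])]).
split=> [|a sa y]; last first.
  by apply: sub_gen_smallest; exact: automaton_closed.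
split=> [y|a b ha hb y]; first by rewrite section1.
rewrite sectionM sectionV.
have [z ->] : exists z, b^-1%g (a [:: y]) = [:: z].
  have : size (b^-1%g (a [:: y])) = 1%N by rewrite !size_act.
  by case: (_ (a _)) => [//|z []//]; exists z.
exact: gV.
Qed.

Definition gsection (g : autgroup) (x : 'I_m) : autgroup :=
  Sub (section (val g) [:: x])
    (mem_set (generated_section x (set_mem (valP g)))).

Definition level_transitive (H : set autgroup) : Prop :=
  forall n (u v : n.-tuple 'I_m),
    exists2 g, H g & act (val g) u = v :> seq 'I_m.

End AutomatonGroup.

Section Probability.
Context {R : realType}.

Definition mass d (T : measurableType d) (mu : probability T R) (x : T) :
  \bar R := mu [set x].

Definition supp d (T : measurableType d) (mu : probability T R) : set T :=
  [set x | mass mu x != 0%E].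

Definition entropy_term (T : choiceType) (p : T -> \bar R) (x : T) : \bar R :=
  (- (fine (p x) * ln (fine (p x))))%:E.

Definition entropy (T : choiceType) (p : T -> \bar R) : \bar R :=
  \esum_(x in [set: T]) entropy_term p x.

Definition entropy_tight d (T : measurableType d) (I : Type)
    (mu_ : I -> probability T R) : Prop :=
  forall eps : R, 0 < eps -> exists2 K : set T, finite_set K &
    forall i, (\esum_(x in ~` K) entropy_term (mass (mu_ i)) x < eps%:E)%E.

Definition convolution (G : groupType) (p q : G -> \bar R) (g : G) : \bar R :=
  \esum_(h in [set: G]) (p h * q (h^-1 * g)%g)%E.

Fixpoint convolution_power (G : groupType) (p : G -> \bar R) (n : nat) :
    G -> \bar R :=
  if n is n'.+1 then convolution (convolution_power p n') p
  else fun g => (g == 1%g)%:R%:E.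

Definition asymptotic_entropy (G : groupType) (p : G -> \bar R) : \bar R :=
  limn (fun n => (n%:R^-1)%:E * entropy (convolution_power p n))%E.

Definition weak_cvg d (T : measurableType d) (mu_ : nat -> probability T R)
    (nu : probability T R) : Prop :=
  forall f : discrete_topology T -> R, continuous f ->
    (exists M, forall x, `|f x| <= M) ->
    (fun n => \int[mu_ n]_x f x) @ \oo --> \int[nu]_x f x.

Definition subsequential_weak_limit d (T : measurableType d)
    (mu_ : nat -> probability T R) (nu : probability T R) : Prop :=
  exists2 phi : nat -> nat, {homo phi : i j / (i < j)%N} &
    weak_cvg (mu_ \o phi) nu.

Definition mutually_independent d (Omega : measurableType d)
    (P : probability Omega R) d' (T : measurableType d') (I : choiceType)
    (X : I -> {RV P >-> T}) : Prop :=
  forall (J : {fset I}) (B : I -> set T), (forall i, measurable (B i)) ->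
    P (\bigcap_(i in [set` J]) (X i @^-1` B i)) =
    (\prod_(i <- J) P (X i @^-1` B i))%E.

Definition identically_distributed d (Omega : measurableType d)
    (P : probability Omega R) d' (T : measurableType d') (I : Type)
    (X : I -> {RV P >-> T}) (mu : probability T R) : Prop :=
  forall i B, measurable B -> distribution P (X i) B = mu B.

End Probability.

Section Ascension.
Context {R : realType} {m : nat} {A : automaton m}.
Let G := autgroup A.

(* The increment at time [i.+1] is [xs i]. *)
Definition walk (xs : nat -> G) (n : nat) : G := (\prod_(i < n) xs i)%g.

Definition returns (x : 'I_m) (xs : nat -> G) (n : nat) : bool :=
  (0 < n)%N && (act (val (walk xs n)) [:: x] == [:: x]).

(* The value [0] is a dummy for the walks that never return: for i.i.d. steps
   they form a null event, as [x] has a finite orbit. *)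
Definition return_time (x : 'I_m) (xs : nat -> G) : nat :=
  if pselect (exists n, returns x xs n) is left h then ex_minn h else 0%N.

Definition return_section (x : 'I_m) (xs : nat -> G) : G :=
  gsection (walk xs (return_time x xs)) x.

(* [nu = T mu]: [nu] is the law of the section at [x] of the random walk with step law [mu],
   stopped at its first return to the stabilizer of [x]; this determines [nu],
   whatever the probability space carrying the walk. *)
Definition is_ascension (x : 'I_m) (mu nu : probability G R) : Prop :=
  exists d (Omega : measurableType d) (P : probability Omega R)
      (X : nat -> {RV P >-> G}),
    [/\ mutually_independent X, identically_distributed X mu &
        forall B, measurable B ->
          nu B = pushforward P (fun w => return_section x (X ^~ w)) B].

End Ascension.

(* Main.v *)
(* Let [kappa] be the law of the section at [o] at the first return to [o], and
   [F y] the law of the section at [y] at the first visit to [o].  An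
   automorphism is determined by the images and sections of all letters, so
   [H (mu^n)] is at most the sum over the letters [x] of the entropies of the
   [x]-coordinate of the walk in the wreath recursion.  Prolonging that coordinate
   until its number of visits to [o] is a multiple of [r] only increases the
   entropy, up to a constant.  The prolonged element changes only when a block
   of [r] visits ends, and is then multiplied by an independent element of law
   [kappa^r]; this costs [H (kappa^r) + ln (1/s)] per block and [ln (1/(1-s))]
   per step, for any [0 < s < 1].  Letters are permuted, so summed over the
   starting letters there is exactly one expected visit to [o] per unit of time,
   hence at most [n/r] blocks before time [n].  Letting [n], then [r], tend to
   infinity and [s] to [0] gives [h(mu) <= h(kappa)].

   Ascensions inherit level transitivity, so [h(mu) <= h(T^k mu) <=
   H((T^k mu)^r) / r] for all [k] and [r].  Weak convergence together with
   entropy-tightness is stable under convolution powers and makes the entropy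
   upper semicontinuous, which gives [h(mu) <= H(nu^r) / r]. *)

From HB Require Import structures.
Require Import Defs.
From mathcomp Require Import all_boot all_order all_algebra finmap.
From mathcomp Require Import all_classical all_reals all_analysis.
From mathcomp Require Import ring lra.

Set Implicit Arguments.
Unset Strict Implicit.
Unset Printing Implicit Defensive.

Import Order.TTheory GRing.Theory Num.Theory.
Import numFieldNormedType.Exports.

Local Open Scope classical_set_scope.
Local Open Scope ring_scope.

(** * Sums over arbitrary index sets *)

Section EsumComplements.
Context {R : realType}.
Local Open Scope ereal_scope.

(** Each return to [o] multiplies the section by an independent element of law [kappa]; paying for
    returns one at a time would only give h(mu) <= H(kappa). Blocks of [r] returns replace H(kappa)
    by H(kappa^r) / r. The probability that a block ends depends on the time and the starting
    letter; comparing it with a fixed [s] makes the price linear in it, so that only the total mass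
    of the endings matters.

    Apart from the given ascension, random objects are replaced by nonnegative functions on the
    group, a semiring under convolution, and facts about the prolonged walk become identities of
    matrices over it. The probability space of an ascension serves to bound [hitting (law mu) o o]
    by [law nu]; equality follows since both have mass 1. That first-visit laws have mass 1 is a
    maximum principle on the finitely many letters, and the bound supplies the finiteness it
    requires.

    Entropy-tightness does not prevent mass from escaping: moving Dirac masses have entropy 0.
    Tightness of the masses comes from the limit being a probability, and both kinds of tails are
    carried through convolutions. *)

Lemma esumZl (T : choiceType) (D : set T) (a : T -> \bar R) (c : \bar R) :
  0 <= c -> (forall i, 0 <= a i) ->
  \esum_(i in D) (c * a i) = c * \esum_(i in D) a i.
Proof.
move=> c0 a0.
have ca0 i : 0 <= c * a i by rewrite mule_ge0.
have up (k : \bar R) (b : T -> \bar R) : 0 <= k -> (forall i, 0 <= b i) ->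
    \esum_(i in D) (k * b i) <= k * \esum_(i in D) b i.
  move=> k0 b0; apply: ge_ereal_sup => _ /= [X XD] <-.
  rewrite -ge0_mule_fsumr//.
  by apply: lee_wpmul2l => //; apply: esum_ge; exists X.
apply/eqP; rewrite eq_le up//=.
move: c c0 ca0 => [r r0 ca0|_ ca0|]; last by [].
- have [->|rN0] := eqVneq r 0%R; first by rewrite mul0e esum_ge0// => i; rewrite mul0e.
  have rp : (0 < r)%R by rewrite lt_neqAle eq_sym rN0 -lee_fin.
  (* The reverse inequality is [up] for the scalar [r^-1] and the family [r * a i]. *)
  have := up r^-1%:E (fun i => r%:E * a i).
  rewrite lee_fin invr_ge0 ltW// => /(_ isT ca0).
  under eq_esum do rewrite muleA -EFinM mulVf// mul1e.
  by rewrite -(@lee_pmul2l _ r%:E)// muleA -EFinM mulfV// mul1e.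
- have [s0|sN0] := eqVneq (\esum_(i in D) a i) 0.
    by rewrite s0 mule0 esum_ge0.
  have [i Di ai] : exists2 i, D i & a i != 0.
    apply: contrapT => h; move/eqP: sN0; apply.
    by rewrite esum1// => i Di; apply/eqP/negP => /negP ai; apply: h; exists i.
  apply: (@le_trans _ _ +oo); first by rewrite leey.
  apply: esum_ge; exists [set i]; first by split => // _ ->.
  by rewrite fsbig_set1 gt0_mulye// lt_neqAle eq_sym ai a0.
Qed.

Lemma esumZr (T : choiceType) (D : set T) (a : T -> \bar R) (c : \bar R) :
  0 <= c -> (forall i, 0 <= a i) ->
  \esum_(i in D) (a i * c) = (\esum_(i in D) a i) * c.
Proof. by move=> *; rewrite muleC -esumZl//; under eq_esum do rewrite muleC. Qed.

Lemma esum_ge1 (T : choiceType) (D : set T) (a : T -> \bar R) (i : T) :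
  (forall i, 0 <= a i) -> D i -> a i <= \esum_(i in D) a i.
Proof.
move=> a0 Di; apply: esum_ge; exists [set i]; first by split => // _ ->.
by rewrite fsbig_set1.
Qed.

Lemma esum_eq0 (T : choiceType) (D : set T) (a : T -> \bar R) (i : T) :
  (forall i, 0 <= a i) -> \esum_(i in D) a i = 0 -> D i -> a i = 0.
Proof.
by move=> a0 s0 Di; apply/eqP; rewrite eq_le a0 andbT -s0 esum_ge1.
Qed.

Lemma exchange_esum (T U : choiceType) (D : set T) (E : set U)
    (a : T -> U -> \bar R) : (forall i j, 0 <= a i j) ->
  \esum_(i in D) \esum_(j in E) a i j = \esum_(j in E) \esum_(i in D) a i j.
Proof.
move=> a0; rewrite !esum_esum//.
rewrite (reindex_esum (E `*` D) _ (fun x => (x.2, x.1)))//; split => //=.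
- by move=> [i j] [/=].
- by move=> [i1 i2] [j1 j2] /= _ _ [] -> ->.
- by move=> [i1 i2] [Pi1 Qi2] /=; exists (i2, i1).
Qed.

Lemma esum_fiber (T U : choiceType) (D : set T) (f : T -> U)
    (a : T -> \bar R) : (forall i, 0 <= a i) ->
  \esum_(u in [set: U]) \esum_(i in D `&` f @^-1` [set u]) a i =
  \esum_(i in D) a i.
Proof.
move=> a0.
under eq_esum do rewrite esum_mkcondr.
rewrite exchange_esum; last by move=> u i; case: ifP.
apply: eq_esum => i Di; rewrite -[RHS](@esum_set1 _ _ (f i) (fun=> a i))//.
rewrite [RHS]esum_mkcond; apply: eq_esum => u _.
by congr (if _ then _ else _); apply/idP/idP; rewrite !inE.
Qed.

Lemma esum_prod (T U : choiceType) (a : T * U -> \bar R) :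
  (forall i, 0 <= a i) ->
  \esum_(x in [set: T * U]) a x =
  \esum_(i in [set: T]) \esum_(j in [set: U]) a (i, j).
Proof.
move=> a0; rewrite esum_esum//; apply: congr2 => //; last first.
  by apply/funext => -[].
by apply/seteqP; split.
Qed.

Lemma esum_fin (T : finType) (a : T -> \bar R) : (forall i, 0 <= a i) ->
  \esum_(i in [set: T]) a i = \sum_i a i.
Proof.
have fT : finite_set [set: T] by exact: finite_finset.
move=> a0; rewrite esum_fset// fsbig_finite//.
apply: perm_big; apply: uniq_perm; rewrite ?index_enum_uniq//.
by move=> i; rewrite mem_index_enum in_fset_set// in_setT.
Qed.

Lemma esum_bij (T U : choiceType) (f : T -> U) (g : U -> T)
    (a : U -> \bar R) : cancel f g -> cancel g f ->
  \esum_(j in [set: U]) a j = \esum_(i in [set: T]) a (f i).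
Proof.
move=> fK gK; apply: reindex_esum; split => //.
- by move=> x y _ _ /(congr1 g); rewrite !fK.
- by move=> y _; exists (g y).
Qed.

Lemma subset_esum (T : choiceType) (D E : set T) (a : T -> \bar R) :
  (forall i, 0 <= a i) -> D `<=` E ->
  \esum_(i in D) a i <= \esum_(i in E) a i.
Proof.
move=> a0 DE; rewrite esum_mkcond [leRHS]esum_mkcond; apply: le_esum => i _.
case: ifPn => [|_]; last by case: ifP.
by rewrite inE => /DE /mem_set ->.
Qed.

End EsumComplements.

(** * The concave function -a ln a *)

Section Eta.
Context {R : realType}.
Implicit Types a b c s : R.

Definition eta a : R := - (a * ln a).

Lemma eta0 : eta 0 = 0. Proof. by rewrite /eta mul0r oppr0. Qed.
Lemma eta_ge0 a : 0 <= a <= 1 -> 0 <= eta a.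
Proof. by move=> /andP[a0 a1]; rewrite oppr_ge0 mulr_ge0_le0// ln_le0. Qed.

(** The right-hand side is the tangent of the concave function [eta] at [c]. Most entropy
    inequalities below are this one with a suitable tangent point. *)
Lemma gibbs a c : 0 <= a -> 0 < c -> eta a <= - (a * ln c) + (c - a).
Proof.
rewrite le_eqVlt => /orP[/eqP<-|a0] c0.
  by rewrite eta0 mul0r oppr0 add0r addr0 ltW.
have h : ln (c / a) <= c / a - 1.
  rewrite -{1}(subrK 1 (c / a)) addrC le_ln1Dx//.
  by rewrite ltrBrDr addrC subrr divr_gt0.
rewrite ln_div ?posrE// in h.
have := ler_wpM2l (ltW a0) h.
rewrite !mulrBr mulr1 mulrCA divff ?gt_eqF// mulr1 /eta; lra.
Qed.

Lemma etaM a b : 0 <= a -> 0 <= b -> eta (a * b) = a * eta b + b * eta a.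
Proof.
rewrite le_eqVlt => /orP[/eqP<- b0|a0].
  by rewrite mul0r eta0 mul0r mulr0 addr0.
rewrite le_eqVlt => /orP[/eqP<-|b0].
  by rewrite mulr0 eta0 mul0r mulr0 addr0.
by rewrite /eta lnM ?posrE//; ring.
Qed.

(** Tangents at [s (a + b)] and [(1 - s) (a + b)]: their corrections cancel, and the logarithms
    split into [ln (a + b)] and the price of [s]. *)
Lemma eta_split a b s : 0 <= a -> 0 <= b -> 0 < s < 1 ->
  eta a + eta b <= eta (a + b) + (- (a * ln s) - b * ln (1 - s)).
Proof.
move=> a0 b0 /andP[s0 s1].
have [ab0|abN0] := eqVneq (a + b) 0.
  have /andP[/eqP-> /eqP->] : (a == 0) && (b == 0) by rewrite -paddr_eq0// ab0.
  by rewrite addr0 eta0 !mul0r oppr0 !addr0.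
have t0 : 0 < a + b by rewrite lt_neqAle eq_sym abN0 addr_ge0.
have s1' : 0 < 1 - s by rewrite subr_gt0.
have := gibbs a0 (mulr_gt0 s0 t0); have := gibbs b0 (mulr_gt0 s1' t0).
rewrite !lnM ?posrE// => h1 h2; apply: le_trans (lerD h2 h1) _.
rewrite /eta le_eqVlt; apply/orP; left; apply/eqP; ring.
Qed.

Lemma eta_sub a s : 0 <= a <= s -> a * - ln s <= eta a.
Proof.
move=> /andP[a0 as_]; rewrite /eta -mulrN.
have [->|aN0] := eqVneq a 0; first by rewrite !mul0r.
have ap : 0 < a by rewrite lt_neqAle eq_sym aN0.
by rewrite ler_wpM2l// lerN2 ler_ln ?posrE// (lt_le_trans ap).
Qed.

Lemma eta_le1 a : 0 <= a -> eta a <= 1.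
Proof.
move=> a0; apply: le_trans (gibbs a0 ltr01) _.
by rewrite ln1 mulr0 oppr0 add0r lerBlDr lerDl.
Qed.

(* Concavity: with [a = k u], [eta a = u (eta k) + k (eta u)]. *)
Lemma eta_dom a k : 0 <= a <= k -> k <= 1 -> eta a <= eta k + k.
Proof.
move=> /andP[a0 ak] k1; have [k0|kN0] := eqVneq k 0.
  have -> : a = 0 by apply/eqP; rewrite eq_le a0 andbT -k0.
  by rewrite k0 eta0 addr0.
have kp : 0 < k by rewrite lt_neqAle eq_sym kN0 (le_trans a0).
rewrite -(divfK kN0 a) etaM ?divr_ge0 ?(ltW kp)//; apply: lerD.
  by rewrite ler_piMl ?eta_ge0 ?(ltW kp)// ler_pdivrMr// mul1r.
by rewrite ler_piMr ?(ltW kp)// eta_le1// divr_ge0// ltW.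
Qed.

End Eta.

(** * Entropy of subprobabilities *)

Section RealEntropy.
Context {R : realType}.

Lemma etaD (a b : R) : 0 <= a -> 0 <= b -> eta (a + b) <= eta a + eta b.
Proof.
move=> a0 b0; have -> : eta (a + b) = a * - ln (a + b) + b * - ln (a + b).
  by rewrite /eta; ring.
by apply: lerD; apply: eta_sub; rewrite ?a0 ?b0 ?lerDl ?lerDr.
Qed.

(** All tangents are taken at the mean of the [a i]. *)
Lemma sum_eta_le (I : finType) (a : I -> R) : (forall i, 0 <= a i) ->
  \sum_i eta (a i) <= eta (\sum_i a i) + (\sum_i a i) * ln #|I|%:R.
Proof.
move=> a0; set A := \sum_i a i.
have A0 : 0 <= A by exact: sumr_ge0.
have [Az|AN0] := eqVneq A 0.
  rewrite Az eta0 mul0r addr0 big1// => i _.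
  have /eqP := Az; rewrite psumr_eq0// => /allP /(_ i).
  by rewrite mem_index_enum => /(_ isT) /eqP ->; rewrite eta0.
have Ap : 0 < A by rewrite lt_neqAle eq_sym AN0.
have n0 : 0 < #|I|%:R :> R.
  rewrite ltr0n; apply: contraTT Ap; rewrite -eqn0Ngt => /eqP c0.
  by rewrite /A big1 ?ltxx// => i; have := card0_eq c0 i.
have c0 : 0 < A / #|I|%:R by rewrite divr_gt0.
apply: (@le_trans _ _
    (\sum_i (- (a i * ln (A / #|I|%:R)) + (A / #|I|%:R - a i)))).
  by apply: ler_sum => i _; exact: gibbs.
rewrite big_split/= sumrN -mulr_suml -/A sumrB sumr_const -/A.
rewrite -[(_ / _) *+ _]mulr_natr divfK ?gt_eqF// subrr addr0.
by rewrite ln_div ?posrE// /eta mulrBr opprB addrC.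
Qed.

Lemma ln_prod_seq (I : Type) (r : seq I) (c : I -> R) :
  (forall i, 0 < c i) -> ln (\prod_(i <- r) c i) = \sum_(i <- r) ln (c i).
Proof.
move=> c0; elim: r => [|i r ih]; first by rewrite !big_nil ln1.
by rewrite !big_cons lnM ?posrE ?prodr_gt0// ih.
Qed.

End RealEntropy.

Section Entropy.
Context {R : realType}.
Local Open Scope ereal_scope.

Definition eeta (x : \bar R) : \bar R := (eta (fine x))%:E.

Lemma eeta0 : eeta 0 = 0. Proof. by rewrite /eeta eta0. Qed.

Lemma eeta_ge0 x : 0 <= x <= 1 -> 0 <= eeta x.
Proof.
case: x => [r| |] /andP[x0 x1]//.
by rewrite lee_fin eta_ge0// -!lee_fin x0.
Qed.

Lemma eetaM x y : 0 <= x <= 1 -> 0 <= y <= 1 ->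
  eeta (x * y) = x * eeta y + y * eeta x.
Proof.
case: x => [x| |] /andP[x0 x1]//; case: y => [y| |] /andP[y0 y1]//.
by rewrite /eeta/= etaM -?lee_fin.
Qed.

(** Mass at most 1, because entropies are also taken of the part of a law carried by an event. *)
Definition subprob (T : choiceType) (p : T -> \bar R) :=
  (forall x, 0 <= p x) /\ \esum_(x in [set: T]) p x <= 1.

Section EsumEta.
Context {T : choiceType}.
Implicit Types (D : set T) (a b w p : T -> \bar R).

Lemma subprob01 p : subprob p -> forall x, 0 <= p x <= 1.
Proof.
by move=> [p0 p1] x; rewrite p0/=; apply: le_trans p1; exact: esum_ge1.
Qed.

Lemma subprob_fin p : subprob p -> forall x, p x \is a fin_num.
Proof.
move=> hp x; have /andP[p0 p1] := subprob01 hp x.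
by rewrite ge0_fin_numE// (le_lt_trans p1)// ltry.
Qed.

Lemma subprobW p a : subprob p -> (forall x, 0 <= a x <= p x) -> subprob a.
Proof.
move=> [p0 p1] ap; split=> [x|]; first by have /andP[] := ap x.
by apply: le_trans p1; apply: le_esum => x _; have /andP[] := ap x.
Qed.

Lemma eeta_subprob_ge0 p : subprob p -> forall x, 0 <= eeta (p x).
Proof. by move=> hp x; apply/eeta_ge0/subprob01. Qed.

Lemma entropy_ge0 p : subprob p -> 0 <= entropy p.
Proof. by move=> hp; apply: esum_ge0 => x _; exact: eeta_subprob_ge0. Qed.

Lemma eeta_esum_le a : subprob a ->
  eeta (\esum_(i in [set: T]) a i) <= entropy a.
Proof.
move=> ha; have [a0 a1] := ha; set S := \esum_(i in _) a i in a1 *.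
have S0 : 0 <= S by apply: esum_ge0 => i _; exact: a0.
have Sf : S \is a fin_num by rewrite ge0_fin_numE// (le_lt_trans a1)// ltry.
have lnS : 0 <= (- ln (fine S))%:E.
  by rewrite lee_fin oppr_ge0 ln_le0// -lee_fin fineK.
have -> : eeta S = \esum_(i in [set: T]) (a i * (- ln (fine S))%:E).
  by rewrite esumZr// -/S -{2}(fineK Sf) -EFinM mulrN.
apply: le_esum => i _; rewrite -[a i]fineK ?subprob_fin// -EFinM lee_fin.
apply: eta_sub; rewrite fine_ge0//= fine_le ?subprob_fin//.
exact: esum_ge1.
Qed.

(** Jensen's inequality, by averaging the tangent at the mean [c]. *)
Lemma eeta_concave w a : (forall i, 0 <= w i) ->
  \esum_(i in [set: T]) w i = 1 -> (forall i, 0 <= a i <= 1) ->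
  \esum_(i in [set: T]) (w i * eeta (a i)) <=
  eeta (\esum_(i in [set: T]) (w i * a i)).
Proof.
move=> w0 w1 a01.
have a0 i : 0 <= a i by have /andP[] := a01 i.
have wa0 i : 0 <= w i * a i by rewrite mule_ge0.
set c := \esum_(i in _) (w i * a i).
have c0 : 0 <= c by exact: esum_ge0.
have c1 : c <= 1.
  rewrite -w1; apply: le_esum => i _; rewrite -[leRHS]mule1.
  by apply: lee_wpmul2l => //; have /andP[] := a01 i.
have cf : c \is a fin_num by rewrite ge0_fin_numE// (le_lt_trans c1)// ltry.
have [cz|cN0] := eqVneq c 0.
  rewrite cz eeta0 le_eqVlt; apply/orP; left; apply/eqP; rewrite esum1// => i _.
  have /eqP := esum_eq0 (i := i) wa0 cz I.
  by rewrite mule_eq0 => /orP[] /eqP ->; rewrite ?mul0e// eeta0 mule0.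
have cp : (0 < fine c)%R by rewrite fine_gt0// lt_neqAle eq_sym cN0 c0/= ltey_eq cf.
have lnc : 0 <= (- ln (fine c))%:E.
  by rewrite lee_fin oppr_ge0 ln_le0// -lee_fin fineK.
have e0 i : 0 <= w i * eeta (a i) by rewrite mule_ge0// eeta_ge0.
(* The tangent contains the correction [c - a i], of either sign; adding [c] to both sides leaves
   only nonnegative sums. *)
suff : \esum_(i in [set: T]) (w i * eeta (a i)) + c <= eeta c + c.
  by rewrite leeD2rE.
rewrite {1}/c -esumD//.
apply: (@le_trans _ _ (\esum_(i in [set: T])
    (w i * a i * (- ln (fine c))%:E + w i * c))).
  apply: le_esum => i _.
  rewrite -muleA -!ge0_muleDr ?mule_ge0// ?eeta_ge0//.
  apply: lee_wpmul2l => //.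
  have aif : a i \is a fin_num.
    by rewrite ge0_fin_numE//; have /andP[_ /le_lt_trans->] := a01 i; rewrite ?ltry.
  have := gibbs (fine_ge0 (a0 i)) cp; rewrite -(fineK aif) /eeta/=.
  by rewrite -(fineK cf)/= -EFinM -!EFinD lee_fin; lra.
rewrite esumD; first last.
- by move=> i _; rewrite mule_ge0.
- by move=> i _; rewrite mule_ge0.
rewrite !esumZr// w1 mul1e -/c leeD2r// -{1}(fineK cf) -EFinM lee_fin.
by rewrite mulrN.
Qed.

Lemma entropyD a b : subprob (fun x => a x + b x) -> (forall x, 0 <= a x) ->
  (forall x, 0 <= b x) ->
  entropy (fun x => a x + b x) <= entropy a + entropy b.
Proof.
move=> ab a0 b0.
have ha : subprob a by apply: subprobW ab _ => x; rewrite a0 leeDl.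
have hb : subprob b by apply: subprobW ab _ => x; rewrite b0 leeDr.
rewrite -esumD; [|move=> x _; exact: eeta_subprob_ge0..].
apply: le_esum => x _; rewrite lee_fin/=.
by rewrite fineD ?subprob_fin//; apply: etaD; rewrite fine_ge0.
Qed.

(** The entropy of the event separating [a] from [b] is replaced by its cross entropy against
    [(s, 1 - s)], which is linear in the masses and can be summed over times at which these vary. *)
Lemma entropy_split a b (s : R) : subprob (fun x => a x + b x) ->
  (forall x, 0 <= a x) -> (forall x, 0 <= b x) -> (0 < s < 1)%R ->
  entropy a + entropy b <= entropy (fun x => a x + b x) +
    ((\esum_(x in [set: T]) a x) * (- ln s)%:E +
     (\esum_(x in [set: T]) b x) * (- ln (1 - s))%:E).
Proof.
move=> ab a0 b0 s01; have /andP[s0 s1] := s01.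
have ha : subprob a by apply: subprobW ab _ => x; rewrite a0 leeDl.
have hb : subprob b by apply: subprobW ab _ => x; rewrite b0 leeDr.
have l0 : 0 <= (- ln s)%:E by rewrite lee_fin oppr_ge0 ln_le0// ltW.
have l1 : 0 <= (- ln (1 - s))%:E.
  by rewrite lee_fin oppr_ge0 ln_le0// gerBl ltW.
rewrite -!esumZr// -!esumD; first last;
  try by move=> x _; rewrite ?adde_ge0 ?mule_ge0//; apply: eeta_subprob_ge0.
apply: le_esum => x _.
rewrite -(fineK (subprob_fin ha x)) -(fineK (subprob_fin hb x)).
rewrite /entropy_term fineD ?subprob_fin//= lee_fin !mulrN.
by apply: eta_split => //; exact: fine_ge0.
Qed.

(** At each point the mass is shared among [#|I|] indices, so forgetting the index loses at most
    [ln #|I|]. *)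
Lemma sum_entropy_le (I : finType) (p : I -> T -> \bar R) :
  (forall i x, 0 <= p i x) -> subprob (fun x => \sum_i p i x) ->
  \sum_i entropy (p i) <=
  entropy (fun x => \sum_i p i x) + (ln #|I|%:R)%:E.
Proof.
move=> p0 hs.
have hp i : subprob (p i).
  apply: subprobW hs _ => x; rewrite p0/= (bigD1 i)//= leeDl//.
  by apply: sume_ge0 => j _; exact: p0.
have [I0|I1] := posnP #|I|.
  rewrite big1; last by move=> i _; have := card0_eq I0 i.
  by rewrite adde_ge0 ?entropy_ge0// I0 lee_fin ln0.
have lnI : 0 <= (ln #|I|%:R)%:E :> \bar R by rewrite lee_fin ln_ge0// ler1n.
rewrite -esum_sum; last by move=> x i _ _; exact: eeta_subprob_ge0.
apply: (@le_trans _ _ (entropy (fun x => \sum_i p i x) +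
    (\esum_(x in [set: T]) \sum_i p i x) * (ln #|I|%:R)%:E)); last first.
  rewrite leeD2l// -[leRHS]mul1e lee_wpmul2r//; exact: hs.2.
rewrite -esumZr//; last exact: hs.1.
rewrite -esumD; first last.
- by move=> x _; rewrite mule_ge0//; exact: hs.1.
- by move=> x _; exact: (eeta_subprob_ge0 hs).
apply: le_esum => x _.
rewrite /entropy_term (_ : \sum_i p i x = (\sum_i fine (p i x))%:E).
  by rewrite sumEFin lee_fin/=; apply: sum_eta_le => i; exact: fine_ge0.
by rewrite -sumEFin; apply: eq_bigr => i _; rewrite fineK// subprob_fin.
Qed.

(** By [etaM], [c * eta (p x)] is at most [eta (c * p x)], to which [eta_dom] applies; the sum gives
    [c * entropy p <= entropy k + 1]. *)
Lemma entropy_dominated (p k : T -> \bar R) (c : R) : subprob p -> subprob k ->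
  (0 < c <= 1)%R -> (forall x, c%:E * p x <= k x) ->
  entropy k < +oo -> entropy p < +oo.
Proof.
move=> hp hk /andP[c0 c1] pk kfin.
have p0 := hp.1.
have ce : 0 <= c%:E <= 1 by rewrite !lee_fin ltW.
have : c%:E * entropy p <= entropy k + 1.
  rewrite -esumZl ?lee_fin ?(ltW c0)//; last exact: eeta_subprob_ge0.
  apply: (@le_trans _ _ (\esum_(x in [set: T]) (eeta (k x) + k x))); last first.
    rewrite esumD; [|by move=> x _; exact: eeta_subprob_ge0|by move=> x _; exact: hk.1].
    by rewrite leeD2l// hk.2.
  apply: le_esum => x _.
  apply: (@le_trans _ _ (eeta (c%:E * p x))).
    rewrite eetaM ?subprob01// leeDl// mule_ge0// ?hp.1// eeta_ge0//.
  have kf := subprob_fin hk x; have pf := subprob_fin hp x.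
  rewrite -{2}(fineK kf) -EFinD lee_fin; apply: eta_dom.
    rewrite fine_ge0 ?mule_ge0 ?p0 ?lee_fin ?(ltW c0)//= fine_le//.
    by rewrite fin_numM.
  by rewrite -lee_fin fineK//; have /andP[] := subprob01 hk x.
rewrite muleC -lee_pdivlMr// => /le_lt_trans; apply.
rewrite muleC lte_mul_pinfty ?lee_fin ?invr_ge0 ?(ltW c0)//.
by rewrite lte_add_pinfty ?ltry.
Qed.

End EsumEta.

(* Summing out the coordinates one at a time. *)
Lemma esum_prod_inj (T U : choiceType) (I : Type) (r : seq I) (f : I -> T -> U)
    (q : I -> U -> \bar R) (D : set T) :
  (forall i, subprob (q i)) ->
  (forall t t', D t -> D t' -> (all (fun i => f i t == f i t') r) -> t = t') ->
  \esum_(t in D) \prod_(i <- r) q i (f i t) <= 1.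
Proof.
move=> hq; have q0 i u : 0 <= q i u by exact: (hq i).1.
have P0 (s : seq I) t : 0 <= \prod_(i <- s) q i (f i t).
  by elim/big_rec : _ => // i x _ x0; rewrite mule_ge0.
elim: r D => [|i r ih] D inj.
  have [->|/set0P[t Dt]] := eqVneq D set0; first by rewrite esum_set0.
  have -> : D = [set t] by apply/seteqP; split=> [t' Dt'|_ ->//]; exact: inj.
  by rewrite esum_set1// big_nil.
rewrite -(@esum_fiber _ _ _ _ (f i))//.
apply: (le_trans _ (hq i).2); apply: le_esum => u _.
apply: (@le_trans _ _ (\esum_(t in D `&` f i @^-1` [set u])
   (q i u * \prod_(j <- r) q j (f j t)))).
  by apply: le_esum => t [Dt /= <-]; rewrite big_cons.
rewrite esumZl// -[leRHS]mule1; apply: lee_wpmul2l => //; apply: ih.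
move=> t t' [Dt /= ft] [Dt' /= ft'] h; apply: inj => //=.
by rewrite ft ft' eqxx.
Qed.

Definition image_weight (T U : choiceType) (f : T -> U) (p : T -> \bar R)
  (u : U) := \esum_(t in f @^-1` [set u]) p t.

Lemma esum_image_weight (T U : choiceType) (f : T -> U) (p : T -> \bar R)
    (phi : U -> \bar R) : (forall t, 0 <= p t) -> (forall u, 0 <= phi u) ->
  \esum_(t in [set: T]) (p t * phi (f t)) =
  \esum_(u in [set: U]) (image_weight f p u * phi u).
Proof.
move=> p0 phi0; rewrite -(@esum_fiber _ _ _ _ f)//; last first.
  by move=> t; rewrite mule_ge0.
apply: eq_esum => u _; rewrite setTI -esumZr//.
by apply: eq_esum => t /= ->.
Qed.

Lemma subprob_image_weight (T U : choiceType) (f : T -> U) (p : T -> \bar R) :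
  subprob p -> subprob (image_weight f p).
Proof.
move=> [p0 p1]; split=> [u|]; first exact: esum_ge0.
rewrite [leLHS](_ : _ = \esum_(u in [set: U]) (image_weight f p u * 1)).
  by rewrite -(esum_image_weight f (phi := fun=> 1))//; under eq_esum do rewrite mule1.
by apply: eq_esum => u _; rewrite mule1.
Qed.

(** Subadditivity of joint entropy. The tangent point at [t] is the product of the marginals, of
    total mass at most 1 because the coordinates determine [t]. *)
Lemma entropy_inj_le (T U I : choiceType) (r : seq I)
    (f : I -> T -> U) (p : T -> \bar R) :
  (forall t, 0 <= p t) -> \esum_(t in [set: T]) p t = 1 ->
  (forall t t', (all (fun i => f i t == f i t') r) -> t = t') ->
  entropy p <= \sum_(i <- r) entropy (image_weight (f i) p).
Proof.
move=> p0 p1 inj; pose q i := image_weight (f i) p.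
have hp : subprob p by split => //; rewrite p1.
have qE i (phi : U -> \bar R) : (forall u, 0 <= phi u) ->
    \esum_(t in [set: T]) (p t * phi (f i t)) =
    \esum_(u in [set: U]) (q i u * phi u).
  by move=> phi0; exact: esum_image_weight.
have hq i : subprob (q i) by exact: subprob_image_weight.
have pq i t : p t <= q i (f i t) by exact: esum_ge1.
pose L i u := (- ln (fine (q i u)))%:E : \bar R.
have L0 i u : 0 <= L i u.
  rewrite lee_fin oppr_ge0 ln_le0// -lee_fin fineK ?subprob_fin//.
  by have /andP[] := subprob01 (hq i) u.
have P0 t : 0 <= \prod_(i <- r) q i (f i t).
  by elim/big_rec : _ => // i x _ x0; rewrite mule_ge0// (hq i).1.
have HE i : entropy (image_weight (f i) p) = \esum_(t in [set: T]) (p t * L i (f i t)).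
  rewrite qE//; apply: eq_esum => u _.
  by rewrite -(fineK (subprob_fin (hq i) u)) -EFinM mulrN.
under eq_bigr do rewrite HE.
rewrite -esum_sum; last by move=> t i _ _; rewrite mule_ge0.
have S0 t : 0 <= \sum_(i <- r) p t * L i (f i t).
  by apply: sume_ge0 => i _; rewrite mule_ge0.
(* On the left the added 1 is the mass of [p]; on the right it bounds the mass of the product of the
   marginals. *)
suff : entropy p + 1 <=
    \esum_(t in [set: T]) (\sum_(i <- r) p t * L i (f i t)) + 1.
  by rewrite leeD2rE.
apply: (@le_trans _ _ (\esum_(t in [set: T])
   (\sum_(i <- r) p t * L i (f i t) + \prod_(i <- r) q i (f i t)))); last first.
  rewrite esumD//.
  by rewrite leeD2l// esum_prod_inj// => t t' _ _; exact: inj.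
rewrite -{1}p1 -esumD//; last by move=> t _; exact: eeta_subprob_ge0.
apply: le_esum => t _.
have pf := subprob_fin hp t.
have [pz|pN0] := eqVneq (p t) 0.
  have -> : entropy_term p t + p t = 0 by rewrite /entropy_term pz/= mul0r oppr0 adde0.
  exact: adde_ge0.
have qf i : q i (f i t) \is a fin_num by exact: subprob_fin.
have pp : (0 < fine (p t))%R by rewrite fine_gt0// lt_neqAle eq_sym pN0 p0/= ltey_eq pf.
have qp i : (0 < fine (q i (f i t)))%R.
  by apply: lt_le_trans pp _; rewrite fine_le.
have -> : \prod_(i <- r) q i (f i t) = (\prod_(i <- r) fine (q i (f i t)))%:E.
  elim: (r) => [|i s ih]; first by rewrite !big_nil.
  by rewrite !big_cons ih EFinM fineK.
have -> : \sum_(i <- r) p t * L i (f i t) =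
    (- (fine (p t) * ln (\prod_(i <- r) fine (q i (f i t)))))%:E.
  rewrite ln_prod_seq// mulr_sumr -sumrN -sumEFin; apply: eq_bigr => i _.
  by rewrite -{1}(fineK pf) -EFinM mulrN.
rewrite -[X in _ + X <= _](fineK pf) -!EFinD lee_fin.
have c0 : (0 < \prod_(i <- r) fine (q i (f i t)))%R by exact: prodr_gt0.
have := gibbs (ltW pp) c0; rewrite /eta; lra.
Qed.

End Entropy.

(** * The convolution semiring *)

(* Weights form a semiring under convolution, so that a walk with finitely many
   internal states is a matrix over it. *)
Record weight (R : realType) (G : groupType) := Weight {
  weight_fun :> G -> \bar R;
  weight_ge0 : forall g, (0 <= weight_fun g)%E }.

HB.instance Definition _ R G := gen_eqMixin (weight R G).
HB.instance Definition _ R G := gen_choiceMixin (weight R G).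

Section Weights.
Context {R : realType} {G : groupType}.
Implicit Types (p q r : weight R G) (g h : G).

Lemma weight_ext p q : p =1 q -> p = q.
Proof.
case: p q => [p p0] [q q0] /= /funext eqf; subst q.
by congr Weight; exact: Prop_irrelevance.
Qed.

Fact zero_weight_ge0 g : (0 <= (fun=> 0) g :> \bar R)%E. Proof. by []. Qed.
Definition zero_weight : weight R G := Weight zero_weight_ge0.

Fact add_weight_ge0 p q g : (0 <= (fun g => p g + q g) g)%E.
Proof. by rewrite adde_ge0 ?weight_ge0. Qed.
Definition add_weight p q : weight R G := Weight (add_weight_ge0 p q).

Fact one_weight_ge0 g : (0 <= (fun g => (g == 1%g)%:R%:E) g :> \bar R)%E.
Proof. by rewrite lee_fin ler0n. Qed.
Definition one_weight : weight R G := Weight one_weight_ge0.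

Fact mul_weight_ge0 p q g : (0 <= convolution p q g)%E.
Proof. by apply: esum_ge0 => h _; rewrite mule_ge0 ?weight_ge0. Qed.
Definition mul_weight p q : weight R G := Weight (mul_weight_ge0 p q).

Local Open Scope ereal_scope.

Fact add_weightA : associative add_weight.
Proof. by move=> p q r; apply: weight_ext => g /=; rewrite addeA. Qed.
Fact add_weightC : commutative add_weight.
Proof. by move=> p q; apply: weight_ext => g /=; rewrite addeC. Qed.
Fact add0weight : left_id zero_weight add_weight.
Proof. by move=> p; apply: weight_ext => g /=; rewrite add0e. Qed.

Fact mul_weightA : associative mul_weight.
Proof.
move=> p q r; apply: weight_ext => g /=; rewrite /convolution.
under eq_esum => h _.
  rewrite -esumZl ?weight_ge0//; last by move=> k; rewrite mule_ge0 ?weight_ge0.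
  over.
under [RHS]eq_esum => h _.
  rewrite -esumZr ?weight_ge0//; last by move=> k; rewrite mule_ge0 ?weight_ge0.
  over.
rewrite [RHS]exchange_esum; last by move=> h k; rewrite !mule_ge0 ?weight_ge0.
apply: eq_esum => h _.
rewrite [RHS](@esum_bij _ _ _ (fun k => h * k)%g (fun k => h^-1 * k)%g).
- by apply: eq_esum => k _; rewrite muleA mulKg invgM mulgA.
- by move=> k; rewrite mulKg.
- by move=> k; rewrite mulVKg.
Qed.

Lemma esum_point (f : G -> \bar R) k : (forall g, 0 <= f g) ->
  \esum_(h in [set: G]) ((h == k)%:R%:E * f h) = f k.
Proof.
move=> f0; rewrite -(@esum_set1 _ _ k f)// [RHS]esum_mkcond.
apply: eq_esum => h _; case: ifPn => [/[!inE] ->|].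
  by rewrite eqxx mul1e.
by rewrite notin_setE => /eqP/negbTE ->; rewrite mul0e.
Qed.

Fact mul1weight : left_id one_weight mul_weight.
Proof.
move=> p; apply: weight_ext => g /=; rewrite /convolution.
by rewrite (esum_point (f := fun h => p (h^-1 * g)%g)) ?invg1 ?mul1g// => h; rewrite weight_ge0.
Qed.

Fact mulweight1 : right_id one_weight mul_weight.
Proof.
move=> p; apply: weight_ext => g /=; rewrite /convolution.
under eq_esum => h _.
  rewrite muleC (_ : (h^-1 * g == 1)%g = (h == g)); last first.
    by rewrite -(inj_eq (mulgI h)) mulVKg mulg1 eq_sym.
  over.
by rewrite (esum_point (f := p))// => h; exact: weight_ge0.
Qed.

Fact mul_weightDl : left_distributive mul_weight add_weight.
Proof.
move=> p q r; apply: weight_ext => g /=; rewrite /convolution -esumD.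
- by apply: eq_esum => h _; rewrite ge0_muleDl ?weight_ge0.
- by move=> h _; rewrite mule_ge0 ?weight_ge0.
- by move=> h _; rewrite mule_ge0 ?weight_ge0.
Qed.

Fact mul_weightDr : right_distributive mul_weight add_weight.
Proof.
move=> p q r; apply: weight_ext => g /=; rewrite /convolution -esumD.
- by apply: eq_esum => h _; rewrite ge0_muleDr ?weight_ge0.
- by move=> h _; rewrite mule_ge0 ?weight_ge0.
- by move=> h _; rewrite mule_ge0 ?weight_ge0.
Qed.

Fact mul0weight : left_zero zero_weight mul_weight.
Proof.
by move=> p; apply: weight_ext => g /=; apply: esum1 => h _; rewrite mul0e.
Qed.
Fact mulweight0 : right_zero zero_weight mul_weight.
Proof.
by move=> p; apply: weight_ext => g /=; apply: esum1 => h _; rewrite mule0.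
Qed.

HB.instance Definition _ := GRing.isPzSemiRing.Build (weight R G)
  add_weightA add_weightC add0weight mul_weightA mul1weight mulweight1
  mul_weightDl mul_weightDr mul0weight mulweight0.

Lemma weightD p q g : (p + q)%R g = p g + q g. Proof. by []. Qed.
Lemma weightM p q g :
  (p * q)%R g = \esum_(h in [set: G]) (p h * q (h^-1 * g)%g).
Proof. by []. Qed.

Lemma weight_sumE (I : Type) (s : seq I) (P : pred I) (p : I -> weight R G) g :
  (\sum_(i <- s | P i) p i)%R g = \sum_(i <- s | P i) p i g.
Proof. by apply: (big_morph (fun w : weight R G => w g)). Qed.

Definition wmass p : \bar R := \esum_(g in [set: G]) p g.

Lemma wmass_ge0 p : 0 <= wmass p.
Proof. by apply: esum_ge0 => g _; exact: weight_ge0. Qed.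

Lemma wmass0 : wmass 0%R = 0. Proof. exact: esum1. Qed.

Lemma wmassD p q : wmass (p + q)%R = wmass p + wmass q.
Proof. by rewrite /wmass -esumD// => g _; exact: weight_ge0. Qed.

Lemma wmass_sum (I : Type) (s : seq I) (P : pred I) (p : I -> weight R G) :
  wmass (\sum_(i <- s | P i) p i)%R = \sum_(i <- s | P i) wmass (p i).
Proof. by apply: (big_morph wmass); [exact: wmassD|exact: wmass0]. Qed.

Lemma wmassM p q : wmass (p * q)%R = wmass p * wmass q.
Proof.
rewrite {1}/wmass; under eq_esum do rewrite weightM.
rewrite exchange_esum; last by move=> g h; rewrite mule_ge0 ?weight_ge0.
rewrite -esumZr ?wmass_ge0//; last exact: weight_ge0.
apply: eq_esum => h _; rewrite -esumZl ?weight_ge0//; last exact: weight_ge0.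
rewrite (@esum_bij _ _ _ (fun k => h * k)%g (fun k => h^-1 * k)%g).
- by apply: eq_esum => k _; rewrite mulKg.
- by move=> k; rewrite mulKg.
- by move=> k; rewrite mulVKg.
Qed.

Lemma wmass1 : wmass 1%R = 1.
Proof.
rewrite /wmass -[RHS](esum_point (f := fun=> 1) 1%g)//.
by apply: eq_esum => g _; rewrite mule1.
Qed.

Lemma wmass1_neq0 p : wmass p = 1 -> exists g, p g != 0.
Proof.
move=> p1; apply: contrapT => np; have p0 : wmass p = 0.
  by apply: esum1 => g _; apply/eqP/negPn/negP => pg; apply: np; exists g.
by move: p1; rewrite p0 => /eqP; rewrite eq_sym onee_eq0.
Qed.

Lemma subprob_weight p : wmass p <= 1 -> subprob p.
Proof. by move=> p1; split=> // g; exact: weight_ge0. Qed.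

Lemma wmassX1 p n : wmass p = 1 -> wmass (p ^+ n)%R = 1.
Proof.
by move=> p1; elim: n => [|n ih]; rewrite ?expr0 ?wmass1// exprS wmassM p1 ih mule1.
Qed.

Lemma convolution_powerE p n : convolution_power p n = (p ^+ n)%R :> (G -> \bar R).
Proof.
elim: n => [|n ih]; first by rewrite expr0.
by rewrite /= ih exprSr.
Qed.

(* Each convolution value is a sum of products, and [eta (x y) = x eta y + y eta x]. *)
Lemma entropyM_le p q : wmass p <= 1 -> wmass q <= 1 ->
  entropy (p * q)%R <= wmass p * entropy q + wmass q * entropy p.
Proof.
move=> p1 q1; have hp := subprob_weight p1; have hq := subprob_weight q1.
have hpq : wmass (p * q)%R <= 1.
  by rewrite wmassM -[leRHS]mule1 lee_pmul ?wmass_ge0.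
have ep := eeta_subprob_ge0 hp; have eq_ := eeta_subprob_ge0 hq.
apply: (@le_trans _ _ (\esum_(g in [set: G]) \esum_(h in [set: G])
    (p h * eeta (q (h^-1 * g)%g) + q (h^-1 * g)%g * eeta (p h)))).
  apply: le_esum => g _; apply: (le_trans (@eeta_esum_le _ _
      (fun h => p h * q (h^-1 * g)%g) _)).
    split=> [h|]; first by rewrite mule_ge0 ?weight_ge0.
    by have /andP[] := subprob01 (subprob_weight hpq) g.
  by apply: le_esum => h _; rewrite -eetaM ?subprob01.
have p0 := @weight_ge0 _ _ p; have q0 := @weight_ge0 _ _ q.
rewrite exchange_esum; last by move=> g h; rewrite adde_ge0 ?mule_ge0.
under eq_esum => h _.
  rewrite esumD; [|by move=> g _; rewrite mule_ge0..].
  rewrite esumZl// esumZr//.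
  rewrite -(@esum_bij _ _ _ (fun g => h^-1 * g)%g (fun g => h * g)%g
     (fun g => eeta (q g))); first last.
  - by move=> k; rewrite mulKg.
  - by move=> k; rewrite mulVKg.
  rewrite -(@esum_bij _ _ _ (fun g => h^-1 * g)%g (fun g => h * g)%g q); first last.
  - by move=> k; rewrite mulKg.
  - by move=> k; rewrite mulVKg.
  over.
rewrite esumD; first last.
- by move=> h _; rewrite mule_ge0//; exact: wmass_ge0.
- by move=> h _; rewrite mule_ge0//; exact: entropy_ge0 hq.
rewrite esumZr ?esumZl//; first exact: wmass_ge0.
exact: entropy_ge0 hq.
Qed.

Lemma entropyM_leD p q : wmass p <= 1 -> wmass q <= 1 ->
  entropy (p * q)%R <= entropy p + entropy q.
Proof.
move=> p1 q1; apply: le_trans (entropyM_le p1 q1) _; rewrite addeC.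
have hp := subprob_weight p1; have hq := subprob_weight q1.
by apply: leeD; rewrite -[leRHS]mul1e lee_wpmul2r ?entropy_ge0.
Qed.

(** The product is the average, with weights [q], of the right translates of [p]; entropy is concave
    and invariant under translation. *)
Lemma entropy_leM p q : wmass p <= 1 -> wmass q = 1 ->
  entropy p <= entropy (p * q)%R.
Proof.
move=> p1 q1; have hp := subprob_weight p1; have ep := eeta_subprob_ge0 hp.
have q0 := @weight_ge0 _ _ q.
have qeE : \esum_(g in [set: G]) \esum_(k in [set: G])
    (q k * eeta (p (g * k^-1)%g)) = entropy p.
  rewrite exchange_esum; last by move=> g k; rewrite mule_ge0.
  rewrite -[RHS]mul1e -q1 -esumZr//; last exact: entropy_ge0 hp.
  apply: eq_esum => k _; rewrite esumZl//; congr (_ * _).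
  rewrite -(@esum_bij _ _ _ (fun g => g * k^-1)%g (fun g => g * k)%g
    (fun g => eeta (p g)))//.
  - by move=> g; rewrite mulgVK.
  - by move=> g; rewrite mulgK.
rewrite -qeE; apply: le_esum => g _.
apply: le_trans (eeta_concave q0 q1 (fun k => subprob01 hp (g * k^-1)%g)) _.
rewrite le_eqVlt; apply/orP; left; apply/eqP; congr eeta.
rewrite weightM (@esum_bij _ _ _ (fun h => h^-1 * g)%g (fun k => g * k^-1)%g).
- by apply: eq_esum => h _; rewrite invgM invgK mulVKg muleC.
- by move=> h; rewrite invgM invgK mulVKg.
- by move=> k; rewrite invgM invgK mulgVK.
Qed.

Lemma entropyX_lty p n : wmass p = 1 -> entropy p < +oo ->
  entropy (p ^+ n)%R < +oo.
Proof.
move=> p1 pfin; elim: n => [|n ih].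
  rewrite expr0 /entropy esum1 ?ltry// => g _; rewrite /entropy_term /=.
  by case: eqP => _; rewrite ?ln1 ?mulr0 ?mul0r oppr0.
rewrite exprS; apply: le_lt_trans (entropyM_leD _ _) _; rewrite ?p1 ?wmassX1//.
by rewrite lte_add_pinfty.
Qed.

End Weights.

(** * Asymptotic entropy *)

Section Fekete.
Context {R : realType}.

(** The limit is the infimum of the quotients [u n / n], whence the lower bound at every [n]. *)
Lemma fekete (u : nat -> R) : (forall n, 0 <= u n) ->
  (forall m n, u (m + n)%N <= u m + u n) ->
  exists l : R, (fun n => n%:R^-1 * u n) @ \oo --> l /\
    forall n, n%:R * l <= u n.
Proof.
move=> u0 usub.
pose S := [set x : R | exists2 n, (0 < n)%N & x = n%:R^-1 * u n].
have Slb : has_inf S.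
  split; first by exists (1%:R^-1 * u 1%N), 1%N.
  by exists 0 => _ [n _ ->]; rewrite mulr_ge0// invr_ge0.
have lbn n : (0 < n)%N -> inf S <= n%:R^-1 * u n.
  by move=> n0; apply: ge_inf; [exact: Slb.2|exists n].
have l0 : 0 <= inf S by apply: lb_le_inf; [exact: Slb.1|move=> _ [n _ ->]; rewrite mulr_ge0// invr_ge0].
exists (inf S); split; last first.
  move=> [|n]; first by rewrite mul0r.
  have := lbn n.+1 isT; rewrite -(@ler_pM2l _ n.+1%:R)// mulrA.
  by rewrite mulfV ?mul1r// pnatr_eq0.
have umul q k r : u (q * k + r)%N <= q%:R * u k + u r.
  elim: q => [|q ih]; first by rewrite mul0n add0n mul0r add0r.
  rewrite mulSn -addnA; apply: le_trans (usub _ _) _.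
  by rewrite -natr1 mulrDl mul1r [X in _ <= X + _]addrC -addrA lerD2l.
apply/cvgrPdist_le => /= e e0.
have [_ [k k0 ->] hk] := inf_adherent (divr_gt0 e0 (ltr0n R 2)) Slb.
pose B := \sum_(r < k) u r.
have uB r : (r < k)%N -> u r <= B.
  move=> rk; rewrite /B (bigD1 (Ordinal rk))//= lerDl; exact: sumr_ge0.
have B0 : 0 <= B by exact: sumr_ge0.
near=> n.
have n0 : (0 < n)%N by near: n; exists 1%N.
have nR : 0 < n%:R :> R by rewrite ltr0n.
have kR : 0 < k%:R :> R by rewrite ltr0n.
rewrite distrC ger0_norm ?subr_ge0 ?lbn//.
have h1 : u n <= n%:R * (k%:R^-1 * u k) + B.
  rewrite {1}(divn_eq n k); apply: le_trans (umul _ _ _) _.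
  apply: lerD; last by rewrite uB// ltn_pmod.
  rewrite mulrA ler_wpM2r// ler_pdivlMr// -natrM ler_nat; exact: leq_divM.
have h2 : n%:R^-1 * u n <= k%:R^-1 * u k + n%:R^-1 * B.
  rewrite mulrC ler_pdivrMr// mulrDl [n%:R^-1 * B]mulrC divfK ?gt_eqF//.
  by rewrite [_ * n%:R]mulrC.
have h3 : n%:R^-1 * B <= e / 2.
  rewrite mulrC ler_pdivrMr// mulrC -ler_pdivrMr ?divr_gt0//.
  near: n; exact: nbhs_infty_ger.
lra.
Unshelve. all: by end_near.
Qed.

End Fekete.

Section AsymptoticEntropy.
Context {R : realType} {G : groupType}.
Implicit Types p : weight R G.

Lemma asymptotic_entropyP p : wmass p = 1%E -> (entropy p < +oo)%E ->
  exists l : R,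
    [/\ asymptotic_entropy p = l%:E,
        forall n, ((n%:R * l)%:E <= entropy (p ^+ n)%R)%E &
        forall e : R, 0 < e ->
          exists N, forall n, (N <= n)%N ->
            (entropy (p ^+ n)%R <= (n%:R * (l + e))%:E)%E].
Proof.
move=> p1 pfin.
have hp n : subprob (p ^+ n) by apply: subprob_weight; rewrite wmassX1.
pose u n := fine (entropy (p ^+ n)).
have uE n : entropy (p ^+ n) = (u n)%:E.
  by rewrite fineK// ge0_fin_numE ?entropy_ge0// entropyX_lty.
have u0 n : 0 <= u n by rewrite fine_ge0// entropy_ge0.
have [m n|l [lu lb]] := fekete u0.
  by rewrite -lee_fin EFinD -!uE exprD; apply: entropyM_leD; rewrite wmassX1.
exists l; split.
- rewrite /asymptotic_entropy; apply: cvg_lim => //.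
  under eq_fun do rewrite convolution_powerE uE -EFinM.
  by apply: cvg_EFin; [exact: nearW|exact: lu].
- by move=> n; rewrite uE lee_fin.
- move=> e e0; have /cvgrPdist_le/(_ e e0)[N _ hN] := lu.
  exists N.+1 => n Nn; have /= := hN n (ltnW Nn).
  have n0 : 0 < n%:R :> R by rewrite ltr0n (leq_trans _ Nn).
  rewrite uE lee_fin ler_norml => /andP[h _].
  rewrite mulrC -ler_pdivrMr// mulrC; lra.
Qed.

End AsymptoticEntropy.

(** * The wreath recursion *)

Section Letters.
Context {m : nat} {A : automaton m}.
Local Notation G := (autgroup A).
Implicit Types (g h s : G) (x y z : 'I_m).

Definition letter g x : 'I_m := head x (act (val g) [:: x]).

Lemma act_letter g x : act (val g) [:: x] = [:: letter g x].
Proof.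
rewrite /letter; have := size_act (val g) [:: x].
by case: (act _ _) => [|y []].
Qed.

Lemma valM g h : val (g * h)%g = (val g * val h)%g. Proof. by []. Qed.

Lemma letterM g h x : letter (g * h)%g x = letter h (letter g x).
Proof.
by have := act_letter (g * h)%g x; rewrite valM actM !act_letter => -[->].
Qed.

Lemma letter1 x : letter 1%g x = x. Proof. by []. Qed.

Lemma letterK g : cancel (letter g) (letter g^-1%g).
Proof. by move=> x; rewrite -letterM mulgV letter1. Qed.

Lemma letter_inj g : injective (letter g).
Proof. exact: can_inj (letterK g). Qed.

Lemma gsectionM g h x :
  gsection (g * h)%g x = (gsection g x * gsection h (letter g x))%g.
Proof. by apply: val_inj; rewrite /= sectionM act_letter. Qed.

Lemma gsection1 x : gsection (1%g : G) x = 1%g.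
Proof. by apply: val_inj; rewrite /= section1. Qed.

Lemma act_cons g x v :
  act (val g) (x :: v) = letter g x :: act (val (gsection g x)) v.
Proof. by rewrite -cat1s sectionE act_letter. Qed.

Lemma gsection_inj g h : (forall x, letter g x = letter h x) ->
  (forall x, gsection g x = gsection h x) -> g = h.
Proof.
move=> el es; apply: val_inj; apply: aut_ext => -[|x v].
  by have [_ -> _] := actP (val g); have [_ -> _] := actP (val h).
by rewrite !act_cons el es.
Qed.

End Letters.

Section Wreath.
Context {R : realType} {m : nat} {A : automaton m}.
Local Notation G := (autgroup A).
Local Notation wt := (weight R G).
Implicit Types (p q : wt) (g h s : G) (x y z : 'I_m) (w : seq G).
Local Open Scope ereal_scope.

Definition step x g : 'I_m * G := (letter g x, gsection g x).

Fact image_weight_ge0 p x y h : 0 <= image_weight (step x) p (y, h).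
Proof. by apply: esum_ge0 => g _; exact: weight_ge0. Qed.

(** A section of a product involves the section at the image letter. Keeping that letter beside the
    section turns convolution into a matrix product. *)
Definition wreath p : 'M[wt]_m :=
  \matrix_(x, y) Weight (image_weight_ge0 p x y).

Lemma wreathE p x y h : wreath p x y h = image_weight (step x) p (y, h).
Proof. by rewrite mxE. Qed.

Lemma esum_wreath p x (phi : 'I_m * G -> \bar R) : (forall u, 0 <= phi u) ->
  \esum_(g in [set: G]) (p g * phi (step x g)) =
  \sum_y \esum_(h in [set: G]) (wreath p x y h * phi (y, h)).
Proof.
move=> phi0; have p0 := @weight_ge0 _ _ p.
rewrite esum_image_weight//.
rewrite esum_prod; last by move=> u; rewrite mule_ge0// esum_ge0.
rewrite esum_fin; last first.
  by move=> y; apply: esum_ge0 => h _; rewrite mule_ge0// esum_ge0.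
by apply: eq_bigr => y _; apply: eq_esum => h _; rewrite wreathE.
Qed.

Lemma wreathM p q : wreath (p * q)%R = (wreath p *m wreath q)%R.
Proof.
apply/matrixP => x y; apply: weight_ext => h.
rewrite wreathE [in RHS]mxE weight_sumE.
under [RHS]eq_bigr do rewrite weightM.
rewrite -(esum_wreath p x (phi := fun u => wreath q u.1 y (u.2^-1 * h)%g)); last first.
  by move=> u; exact: weight_ge0.
rewrite /image_weight esum_mkcond.
under eq_esum => g _.
  rewrite (_ : (if _ then _ else _) = \esum_(k in [set: G])
      if g \in step x @^-1` [set (y, h)] then p k * q (k^-1 * g)%g else 0); last first.
    by case: ifP => // _; rewrite esum1.
  over.
rewrite exchange_esum; last first.
  by move=> g k; case: ifP => // _; rewrite mule_ge0 ?weight_ge0.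
apply: eq_esum => k _.
rewrite -esum_mkcond esumZl ?weight_ge0//; last by move=> g; exact: weight_ge0.
congr (_ * _); rewrite wreathE/= /image_weight.
(* Once the first factor [k] is fixed, translation by [k^-1] carries the condition on the product
   [g] to a condition on the second factor alone. *)
symmetry; apply: (reindex_esum _ _ (fun g => (k^-1 * g)%g)); split => /=.
- move=> g [lg sg]; rewrite /= /step -letterM mulVKg lg; congr pair.
  by apply: (mulgI (gsection k x)); rewrite -gsectionM !mulVKg sg.
- by move=> g l _ _ /mulgI.
- move=> l /eqP; rewrite xpair_eqE => /andP[/eqP ly /eqP sl].
  exists (k * l)%g; last by rewrite mulKg.
  by rewrite /= /step letterM ly gsectionM sl mulVKg.
Qed.

Lemma wreath1 : wreath 1%R = 1%:M%R.
Proof.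
apply/matrixP => x y; apply: weight_ext => h; rewrite wreathE mxE.
rewrite /image_weight esum_mkcond.
under eq_esum => g _.
  rewrite (_ : (if _ then _ else _) =
    (g == 1%g)%:R%:E * ((step x g == (y, h))%:R%:E : \bar R)); last first.
    case: ifPn => [/[!inE] /= ->|]; first by rewrite eqxx mule1.
    by rewrite notin_setE /= => /eqP/negbTE ->; rewrite mule0.
  over.
rewrite esum_point /step ?letter1 ?gsection1; last by move=> g; rewrite lee_fin.
rewrite xpair_eqE; case: (x == y) => //=.
by rewrite eq_sym.
Qed.

Lemma wmass_wreath p x y :
  wmass (wreath p x y) = \esum_(g in [set g | letter g x = y]) p g.
Proof.
rewrite /wmass; under eq_esum do rewrite wreathE.
rewrite /image_weight -(@esum_fiber _ _ _ [set g | letter g x = y] (fun g => gsection g x));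
  last exact: weight_ge0.
apply: eq_esum => h _; congr (esum _ _); apply/seteqP; split => g /=.
  by move=> [-> ->].
by rewrite /step => -[-> ->].
Qed.

Lemma sum_wmass_wreath p x : \sum_y wmass (wreath p x y) = wmass p.
Proof.
under eq_bigr do rewrite wmass_wreath.
rewrite -esum_fin; last by move=> y; apply: esum_ge0 => g _; exact: weight_ge0.
rewrite /wmass -(@esum_fiber _ _ _ setT (fun g => letter g x)); last exact: weight_ge0.
by apply: eq_esum => y _; rewrite setTI.
Qed.

(** Columns behave like rows because each [g] permutes the letters and so sends exactly one of them
    to [y]. *)
Lemma sum_wmass_wreath_col p y : \sum_x wmass (wreath p x y) = wmass p.
Proof.
under eq_bigr do rewrite wmass_wreath.
rewrite -esum_fin; last by move=> x; apply: esum_ge0 => g _; exact: weight_ge0.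
rewrite /wmass -(@esum_fiber _ _ _ setT (fun g => letter g^-1%g y)); last exact: weight_ge0.
apply: eq_esum => x _; rewrite setTI; congr (esum _ _).
apply/seteqP; split => g /= <-; first by rewrite letterK.
by rewrite -{1}[g]invgK letterK.
Qed.

Lemma entropy_wreath_le p : wmass p = 1 ->
  entropy p <= \sum_x \sum_y entropy (wreath p x y).
Proof.
move=> p1; have p0 := @weight_ge0 _ _ p.
apply: le_trans (entropy_inj_le (r := index_enum 'I_m) (f := step) p0 p1 _) _.
  move=> g h /allP eqs.
  have es x : step x g = step x h by exact/eqP/eqs/mem_index_enum.
  by apply: gsection_inj => x; [exact: (congr1 fst (es x))|exact: (congr1 snd (es x))].
apply: lee_sum => x _.
have hx : subprob (image_weight (step x) p).
  by apply: subprob_image_weight; apply: subprob_weight; rewrite p1.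
rewrite /entropy esum_prod; last exact: eeta_subprob_ge0.
rewrite esum_fin; last by move=> y; apply: esum_ge0 => h _; exact: eeta_subprob_ge0.
apply: lee_sum => y _; apply: le_esum => h _.
by rewrite /entropy_term wreathE.
Qed.

End Wreath.

(** * First visits *)

Section Hitting.
Context {R : realType} {m : nat} {A : automaton m}.
Local Notation G := (autgroup A).
Local Notation wt := (weight R G).
Implicit Types (p q : wt) (g h s : G) (x y z o : 'I_m) (w : seq G).
Local Open Scope ereal_scope.

(* The path from [y] labelled by [w] visits [o] for the first time, not counting
   its origin, at its end. *)
Fixpoint hits o y w : bool :=
  if w is s :: w' then
    if letter s y == o then nilp w' else hits o (letter s y) w'
  else false.

Definition word_prod w : G := (\prod_(s <- w) s)%g.

Definition hitting_words o y g : set (seq G) :=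
  [set w | hits o y w /\ gsection (word_prod w) y = g].

Definition word_weight p w : \bar R := \prod_(s <- w) p s.

Lemma word_weight_ge0 p w : 0 <= word_weight p w.
Proof.
by rewrite /word_weight; elim/big_rec : _ => // s x _ x0; rewrite mule_ge0 ?weight_ge0.
Qed.

(** A sum over words: each word corresponds to a cylinder of the walk, and removing its first letter
    yields a recursion. Nothing bounds the total mass in advance. *)
Definition hitting p o y : wt :=
  Weight (fun g => esum_ge0 (fun w (_ : hitting_words o y g w) => word_weight_ge0 p w)).

Lemma hitting_first_step p o y g :
  hitting p o y g = \esum_(s in [set: G])
    (p s * (if letter s y == o then (gsection s y == g)%:R%:E
            else hitting p o (letter s y) ((gsection s y)^-1 * g)%g)).
Proof.
pose J s : set (seq G) := [set w | hitting_words o y g (s :: w)].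
(* A hitting word is never empty, so it is a first step followed by a rest; [J s] collects the rests
   after [s]. *)
have W0 := word_weight_ge0 p.
transitivity (\esum_(k in [set: G] `*`` J) (p k.1 * word_weight p k.2)).
  rewrite /hitting /= (reindex_esum ([set: G] `*`` J) _ (fun k => k.1 :: k.2)).
    by apply: eq_esum => -[s w] _; rewrite /word_weight big_cons.
  split => /=.
  - by move=> [s w] [].
  - by move=> [s w] [s' w'] _ _ /= [-> ->].
  - by move=> [|s w] hw; [case: hw|exists (s, w)].
rewrite -(esum_esum (a := fun s w => p s * word_weight p w)); last first.
  by move=> s w _ _; rewrite mule_ge0 ?weight_ge0.
apply: eq_esum => s _; rewrite esumZl ?weight_ge0//; congr (_ * _).
have Jw w : J s w ->
    (gsection s y * gsection (word_prod w) (letter s y))%g = g.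
  by move=> [_ <-]; rewrite /word_prod big_cons gsectionM.
case: ifPn => [/eqP so|so].
  have [sg|sg] := eqVneq (gsection s y) g.
    rewrite (_ : J s = [set [::]]).
      by rewrite esum_set1// /word_weight big_nil.
    apply/seteqP; split => [w [/=]|_ ->]; first by rewrite so eqxx => /nilP.
    by split; rewrite /= ?so ?eqxx// /word_prod big_seq1.
  rewrite (_ : J s = set0) ?esum_set0//; apply/seteqP; split => // w Jsw.
  move: (Jw _ Jsw); case: Jsw => /= + _; rewrite so eqxx => /nilP ->.
  by rewrite /word_prod big_nil gsection1 mulg1 => /eqP; rewrite (negbTE sg).
congr (esum _ _); apply/seteqP; split => w.
  move=> Jsw; split; last by rewrite -(Jw _ Jsw) mulKg.
  by case: Jsw => /=; rewrite (negbTE so).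
move=> [hw sw]; split; first by rewrite /= (negbTE so).
by rewrite /word_prod big_cons gsectionM -/(word_prod w) sw mulVKg.
Qed.

Lemma hitting_rec p o y :
  hitting p o y = (wreath p y o +
    \sum_(z | z != o) wreath p y z * hitting p o z)%R.
Proof.
apply: weight_ext => g; rewrite hitting_first_step.
pose phi (u : 'I_m * G) : \bar R := if u.1 == o then (u.2 == g)%:R%:E
  else hitting p o u.1 (u.2^-1 * g)%g.
rewrite (esum_wreath p y (phi := phi)); last first.
  move=> u; rewrite /phi; case: ifP => _; last exact: weight_ge0.
  by rewrite lee_fin.
rewrite weightD weight_sumE (bigD1 o)//; congr (_ + _).
  under eq_esum do rewrite /phi eqxx muleC.
  by rewrite (esum_point (f := wreath p y o))// => h; exact: weight_ge0.
apply: eq_bigr => z zo; rewrite weightM; apply: eq_esum => h _.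
by rewrite /phi (negbTE zo).
Qed.

Lemma hitting_step_last p o y s : letter s y = o ->
  p s <= hitting p o y (gsection s y).
Proof.
move=> so; rewrite hitting_first_step.
set a := (X in \esum_(i in _) X i).
have -> : p s = a s by rewrite /a so !eqxx mule1.
apply: esum_ge1 => // t; rewrite /a mule_ge0 ?weight_ge0//.
by case: ifP => _; rewrite ?weight_ge0// lee_fin.
Qed.

Lemma hitting_step_next p o y s h : letter s y != o ->
  p s * hitting p o (letter s y) h <= hitting p o y (gsection s y * h)%g.
Proof.
move=> so; rewrite [leRHS]hitting_first_step.
set a := (X in \esum_(i in _) X i).
have -> : p s * hitting p o (letter s y) h = a s.
  by rewrite /a (negbTE so) mulKg.
apply: esum_ge1 => // t; rewrite /a mule_ge0 ?weight_ge0//.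
by case: ifP => _; rewrite ?weight_ge0// lee_fin.
Qed.

End Hitting.

(** * Recurrence of the walk on the letters *)

Section Recurrence.
Context {R : realType} {m : nat} {A : automaton m}.
Local Notation G := (autgroup A).
Local Notation wt := (weight R G).
Implicit Types (p q : wt) (g h s : G) (x y z o : 'I_m).
Local Open Scope ereal_scope.

Definition weight_supp p : set G := [set g | p g != 0].

Definition letter_transitive p :=
  forall x y, exists2 g, generated (weight_supp p) g & letter g x = y.

(* As the alphabet is finite, a set of letters stable under a permutation is
   stable under its inverse. *)
Lemma stable_letters p (Q : 'I_m -> Prop) x : letter_transitive p -> Q x ->
  (forall y s, Q y -> p s != 0 -> Q (letter s y)) -> forall y, Q y.
Proof.
move=> ptrans Qx Qs y.
pose K : set G := [set g | forall y, Q y <-> Q (letter g y)].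
have Ksub : is_subgroup K.
  split=> [z|a b Ka Kb z]; first by rewrite letter1.
  have Kb' t : Q (letter b^-1%g t) <-> Q t.
    by have := Kb (letter b^-1%g t); rewrite -letterM mulVg letter1.
  by rewrite letterM; exact: iff_trans (Ka z) (iff_sym (Kb' _)).
have sK : weight_supp p `<=` K.
  move=> s ps z; split => [Qz|Qsz]; first exact: Qs.
  pose S := [set z : 'I_m | `[< Q z >]]%SET.
  have imS : (letter s @: S)%SET = S.
    apply/eqP; rewrite eqEcard card_imset ?leqnn ?andbT; last exact: letter_inj.
    apply/fintype.subsetP => u /imsetP[t tS ->]; rewrite inE; apply/asboolP.
    by apply: Qs => //; move: tS; rewrite inE => /asboolP.
  have : letter s z \in (letter s @: S)%SET by rewrite imS inE; apply/asboolP.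
  by move=> /imsetP[t]; rewrite inE => /asboolP Qt /letter_inj ->.
have [g hg <-] := ptrans x y.
exact: (proj1 (hg K (conj Ksub sK) x)).
Qed.

Lemma wreath_ge p s y : p s <= wmass (wreath p y (letter s y)).
Proof.
by rewrite wmass_wreath; apply: esum_ge1 => // g; exact: weight_ge0.
Qed.

Section HittingMass.
Variables (p : wt) (o : 'I_m).
Hypotheses (p1 : wmass p = 1) (ptrans : letter_transitive p).
Hypothesis ho : wmass (hitting p o o) <= 1.

Let f y := wmass (hitting p o y).
Let a y z := wmass (wreath p y z).

Let frec y : f y = a y o + \sum_(z | z != o) a y z * f z.
Proof.
rewrite /f hitting_rec wmassD wmass_sum; congr (_ + _).
by apply: eq_bigr => z _; rewrite wmassM.
Qed.

Let a_sum y : \sum_z a y z = 1. Proof. by rewrite sum_wmass_wreath. Qed.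

Let a0 y z : 0 <= a y z. Proof. exact: wmass_ge0. Qed.

Let a_fin y z : a y z \is a fin_num.
Proof.
rewrite ge0_fin_numE//; apply: (@le_lt_trans _ _ 1); last by rewrite ltry.
by rewrite -(a_sum y) (bigD1 z)//= leeDl// sume_ge0.
Qed.

Let f_fin y : f y \is a fin_num.
Proof.
rewrite ge0_fin_numE ?wmass_ge0//.
(* Finiteness passes from a letter to its successors, since the recursion gives the step a positive
   coefficient; [ho] provides it at [o]. *)
apply: (stable_letters (Q := fun y => f y < +oo) (x := o) ptrans).
  by rewrite (le_lt_trans ho)// ltry.
move=> {}y s fy ps; have [->|so] := eqVneq (letter s y) o.
  by rewrite (le_lt_trans ho)// ltry.
have : a y (letter s y) * f (letter s y) <= f y.
  rewrite [leRHS]frec (bigD1 (letter s y))//= addeCA leeDl//.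
  by rewrite adde_ge0// sume_ge0// => z _; rewrite mule_ge0 ?wmass_ge0.
have as0 : 0 < a y (letter s y).
  by apply: lt_le_trans (wreath_ge p s y); rewrite lt_neqAle eq_sym ps weight_ge0.
move=> /le_lt_trans/(_ fy); rewrite !ltey; apply: contraNN => /eqP ->.
by rewrite gt0_muley.
Qed.

(** Maximum principle: [f y] is the average of [f] over the next letter, with the value at [o]
    replaced by 1. So the deviation [d] from 1 is at most the average of [d'], which vanishes at
    [o], and a positive maximum would propagate to every letter. *)
Lemma wmass_hitting y : wmass (hitting p o y) = 1.
Proof.
pose ar y z := fine (a y z); pose d y : R := `|fine (f y) - 1|%R.
pose d' z : R := if z == o then 0%R else d z.
have ar0 x z : (0 <= ar x z)%R by exact: fine_ge0.
have ars x : (\sum_z ar x z = 1)%R.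
  apply: EFin_inj; rewrite -sumEFin -[RHS](a_sum x).
  by apply: eq_bigr => z _; rewrite fineK.
have dle x : (d x <= \sum_z ar x z * d' z)%R.
  have fE : (fine (f x) = \sum_z ar x z * (if z == o then 1 else fine (f z)))%R.
    apply: EFin_inj; rewrite fineK// frec -sumEFin [RHS](bigD1 o)//= eqxx mulr1 fineK//.
    by congr (_ + _); apply: eq_bigr => z zo; rewrite (negbTE zo) EFinM !fineK.
  rewrite {1}/d fE -[X in (_ - X)%R](ars x) -sumrB; apply: le_trans (ler_norm_sum _ _ _) _.
  apply: ler_sum => z _; rewrite -[X in (_ - X)%R]mulr1 -mulrBr normrM ger0_norm//.
  by rewrite ler_wpM2l// /d' /d; case: ifP => // _; rewrite subrr normr0.
have [y1 _ dmax1] := @arg_maxP _ _ _ y xpredT d isT.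
have dmax z : (d z <= d y1)%R := dmax1 z isT.
suff d10 : d y1 = 0%R.
  have := dmax y; rewrite d10 /d normr_le0 subr_eq0 => /eqP fy.
  by rewrite -/(f y) -(fineK (f_fin y)) fy.
apply/eqP/negPn/negP => dN0.
have M0 : (0 < d y1)%R by rewrite lt_neqAle eq_sym dN0 normr_ge0.
have d'M z : (d' z <= d y1)%R by rewrite /d'; case: ifP => _; [exact: ltW|exact: dmax].
(* An average of values at most [d y1] reaches [d y1] only if every value of positive weight
   does. *)
have key x s : d x = d y1 -> p s != 0 -> d' (letter s x) = d y1.
  move=> dx ps; apply/eqP; rewrite eq_le d'M/=.
  have as0 : (0 < ar x (letter s x))%R.
    rewrite fine_gt0// ltey_eq a_fin andbT/=.
    by apply: lt_le_trans (wreath_ge p s x); rewrite lt_neqAle eq_sym ps weight_ge0.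
  have := dle x; rewrite dx (bigD1 (letter s x))//= => h.
  have : (\sum_(i | i != letter s x) ar x i * d' i <=
      (1 - ar x (letter s x)) * d y1)%R.
    rewrite -{1}(ars x) [X in (X - _)%R](bigD1 (letter s x))//= addrAC subrr add0r mulr_suml.
    by apply: ler_sum => i _; rewrite ler_wpM2l.
  rewrite mulrBl mul1r => h2; rewrite -(ler_pM2l as0); lra.
have all_d : forall x, d x = d y1.
  apply: (stable_letters (x := y1) ptrans) => // x s dx ps.
  have := key x s dx ps; rewrite /d'; case: ifP => // _ e0.
  by rewrite -e0 ltxx in M0.
(* Some step leads to [o], where [d'] is 0: the propagated maximum is contradicted at the
   predecessor of [o] under [s]. *)
have [s ps] := wmass1_neq0 p1.
have := key (letter s^-1%g o) s (all_d _) ps.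
rewrite -{1}[s]invgK letterK /d' eqxx => e0.
by rewrite -e0 ltxx in M0.
Qed.

(** Starting with the step [s], the law at [y] dominates, up to the factor [p s] and a translation,
    the law at [letter s y]. Finite entropy therefore spreads from [o] along all steps. *)
Lemma entropy_hitting_lty : entropy (hitting p o o) < +oo ->
  forall y, entropy (hitting p o y) < +oo.
Proof.
move=> Ho; have hF y : subprob (hitting p o y).
  by apply: subprob_weight; rewrite wmass_hitting.
apply: (stable_letters ptrans Ho) => y s Hy ps.
have [->//|so] := eqVneq (letter s y) o.
have p01 : subprob p by apply: subprob_weight; rewrite p1.
have bij (phi : G -> \bar R) : \esum_(h in [set: G]) phi (gsection s y * h)%g =
    \esum_(h in [set: G]) phi h.
  rewrite -(@esum_bij _ _ _ (fun h => gsection s y * h)%g (fun h => (gsection s y)^-1 * h)%g)//.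
  - by move=> h; rewrite mulKg.
  - by move=> h; rewrite mulVKg.
have ks : subprob (fun h => hitting p o y (gsection s y * h)%g).
  by split => [h|]; [exact: weight_ge0|rewrite bij; exact: (hF y).2].
apply: (entropy_dominated (hF _) ks (c := fine (p s))) => [|h|].
- have /andP[ps0 ps1] := subprob01 p01 s.
  rewrite fine_gt0 /=; last by rewrite lt_neqAle eq_sym ps ps0 ltey_eq subprob_fin.
  by rewrite -lee_fin fineK ?subprob_fin.
- by rewrite fineK ?subprob_fin//; exact: hitting_step_next.
- by rewrite /entropy (bij (fun h => eeta (hitting p o y h))).
Qed.

End HittingMass.

End Recurrence.

(** * Ascensions *)

Lemma countable_seq (T : Type) : countable [set: T] -> countable [set: seq T].
Proof. by move=> /Pcountable[T' ->]; exact: countableP. Qed.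

(** Values of finite words in the generators and their inverses form a subgroup; such words are
    coded by sequences of signed numbers. *)
Lemma countable_generated (G : groupType) (S : set G) :
  countable S -> countable (generated S).
Proof.
move=> /countable_injP[f finj].
pose e n : G := if pselect (exists2 s, S s & f s = n) is left h
  then s2val (cid2 h) else 1%g.
have eS s : S s -> e (f s) = s.
  rewrite /e; case: pselect => [h Ss|h Ss]; last by case: h; exists s.
  by case: cid2 => t /= St; apply: finj; rewrite inE.
pose sgn (k : nat * bool) : G := if k.2 then (e k.1)^-1%g else e k.1.
pose ev (w : seq (nat * bool)) : G := (\prod_(k <- w) sgn k)%g.
pose K := ev @` [set: seq (nat * bool)].
have evV w : exists w', ev w' = (ev w)^-1%g.
  elim: w => [|k w [w' hw']]; first by exists [::]; rewrite /ev big_nil invg1.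
  exists (rcons w' (k.1, ~~ k.2)).
  rewrite /ev -cats1 big_cat big_seq1 big_cons -/(ev w) -/(ev w') hw' invgM /sgn /=.
  by case: k.2; rewrite ?invgK.
have Ksub : is_subgroup K.
  split=> [|_ _ [w _ <-] [w' _ <-]]; first by exists [::]; rewrite // /ev big_nil.
  have [w'' hw''] := evV w'; exists (w ++ w'') => //.
  by rewrite {1}/ev big_cat/= -/(ev w) -/(ev w'') hw''.
have SK : S `<=` K.
  by move=> s Ss; exists [:: (f s, false)] => //; rewrite /ev big_seq1 /sgn/= eS.
apply: (@sub_countable _ _ _ K); first exact/subset_card_le/(smallest_sub Ksub SK).
exact: sub_countable (card_image_le _ _) (countableP _).
Qed.

Lemma countable_autgroup (m : nat) (A : automaton m) :
  countable [set: autgroup A].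
Proof.
have /countable_injP[f finj] : countable (generated (states A)).
  exact/countable_generated/finite_set_countable/automaton_finite.
apply/countable_injP; exists (fun g : autgroup A => f (val g)) => g h _ _ fgh.
by apply: val_inj; apply: finj => //; rewrite inE; apply/set_mem/valP.
Qed.

Section Law.
Context {R : realType} {m : nat} {A : automaton m}.
Local Notation G := (autgroup A).
Implicit Types mu : probability G R.
Local Open Scope ereal_scope.

Definition law mu : weight R G := Weight (fun g => measure_ge0 mu [set g]).

(** The group is countable, being finitely generated, so countable additivity recovers the total
    mass from the points. *)
Lemma wmass_law mu : wmass (law mu) = 1.
Proof.
have /countable_injP[f finj] := countable_autgroup A.
have fI g h : f g = f h -> g = h by apply: finj; rewrite inE.
rewrite -(probability_setT mu) (_ : [set: G] = \bigcup_n f @^-1` [set n]); last first.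
  by apply/seteqP; split=> // g _; exists (f g).
rewrite measure_semi_bigcup//; last first.
  by apply/trivIsetP => i j _ _ /eqP ij; apply/seteqP; split => // g [/= -> /ij].
rewrite nneseries_esumT//.
rewrite /wmass -(@esum_fiber _ _ _ setT f); last exact: weight_ge0.
apply: eq_esum => n _; rewrite setTI.
have [->|/set0P[g /= gn]] := eqVneq (f @^-1` [set n]) set0.
  by rewrite esum_set0 measure0.
have -> : f @^-1` [set n] = [set g].
  by apply/seteqP; split=> h /=; [rewrite -gn => /fI|move=> ->].
by rewrite esum_set1//; exact: weight_ge0.
Qed.

End Law.

(** * The ascension as a first-return law *)

Section AscensionLaw.
Context {R : realType} {m : nat} {A : automaton m}.
Local Notation G := (autgroup A).
Implicit Types (w : seq G) (o y : 'I_m) (xs : nat -> G).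

Lemma hitsP o y w : hits o y w -> [/\ (0 < size w)%N, letter (word_prod w) y = o &
  forall k, (0 < k < size w)%N -> letter (word_prod (take k w)) y != o].
Proof.
elim: w y => [|s w ih] y //=; case: ifPn => [/eqP so /nilP ->|so].
  by split; rewrite /word_prod ?big_seq1// => -[|k].
move=> /ih[w0 wo wk]; split=> //; first by rewrite /word_prod big_cons letterM.
move=> [|[|k]]// hk.
  by rewrite /word_prod /= take0 big_seq1.
by rewrite /word_prod /= big_cons letterM wk.
Qed.

Lemma returnsE o xs n :
  returns o xs n = (0 < n)%N && (letter (walk xs n) o == o).
Proof. by rewrite /returns act_letter; congr (_ && _); rewrite eqseq_cons andbT. Qed.

(** The clauses also characterize the dummy time 0, which is never a return since [returns] demands
    a positive time. *)
Lemma return_timeP o xs n : return_time o xs = n <->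
  (forall k, (k < n)%N -> ~~ returns o xs k) /\
  (if n is 0 then forall k, ~~ returns o xs k else returns o xs n).
Proof.
rewrite /return_time; case: pselect => [h|h]; last first.
  have nr k : ~~ returns o xs k by apply/negP => rk; apply: h; exists k.
  split=> [<-|[_]]; first by split.
  by case: n => [//|n rn]; case: h; exists n.+1.
case: ex_minnP => k rk kmin; split=> [<-|[hlt hn]].
  split=> [j jk|]; first by apply/negP => /kmin; rewrite leqNgt jk.
  by case: k rk {kmin}.
case: n hlt hn => [|n] hlt hn; first by rewrite (negbTE (hn k)) in rk.
apply/eqP; rewrite eqn_leq kmin//= leqNgt; apply/negP => /hlt.
by rewrite rk.
Qed.

Lemma word_prod_mkseq xs n : word_prod (mkseq xs n) = walk xs n.
Proof.
by rewrite /word_prod /walk big_map -(big_mkord xpredT) /index_iota subn0.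
Qed.

Lemma hits_return o xs w : hits o o w -> mkseq xs (size w) = w ->
  return_time o xs = size w.
Proof.
move=> /hitsP[w0 wo wk] xw; apply/return_timeP; split.
  move=> k kw; rewrite returnsE; case: posnP => //= k0.
  have := wk k; rewrite k0 kw => /(_ isT).
  rewrite -{1}xw /mkseq -map_take take_iota (minn_idPl (ltnW kw)).
  by rewrite -/(mkseq xs k) word_prod_mkseq.
have : returns o xs (size w) by rewrite returnsE w0 -word_prod_mkseq xw wo eqxx.
by case: (size w) w0.
Qed.

Section Process.
Context d {Omega : measurableType d} {P : probability Omega R}.
Variable X : nat -> {RV P >-> G}.
Implicit Type omega : Omega.

Definition cylinder w : set Omega :=
  [set omega | mkseq (fun i => X i omega) (size w) = w].

Lemma cylinderE w : cylinder w =
  \bigcap_(i in [set` [fset i in iota 0 (size w)]%fset])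
    (X i @^-1` [set nth 1%g w i]).
Proof.
apply/seteqP; split => omega /=.
  move=> h i /=; rewrite !inE mem_iota add0n /= => iw.
  by rewrite -[in RHS]h nth_mkseq.
move=> h; apply: (@eq_from_nth _ 1%g); rewrite size_mkseq// => i iw.
by rewrite nth_mkseq// (h i)//= !inE mem_iota.
Qed.

Lemma measurable_cylinder w : measurable (cylinder w).
Proof.
rewrite cylinderE; apply: fin_bigcap_measurable; first exact: finite_fset.
by move=> i _; exact: measurable_funPTI.
Qed.

(** There are countably many words, so an event depending on finitely many steps is a countable
    union of cylinders. *)
Lemma measurable_prefix (Q : seq G -> Prop) n :
  measurable [set omega | Q (mkseq (fun i => X i omega) n)].
Proof.
rewrite (_ : [set omega | _] = \bigcup_w
  (if `[< Q w >] && (size w == n) then cylinder w else set0)).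
  apply: countable_bigcupT_measurable; first exact/countable_seq/countable_autgroup.
  by move=> w; case: ifP => // _; exact: measurable_cylinder.
apply/seteqP; split => omega /=.
  move=> Qw; exists (mkseq (fun i => X i omega) n) => //.
  by rewrite size_mkseq eqxx andbT asboolT//= /cylinder/= size_mkseq.
by move=> [w _]; case: ifP => // /andP[/asboolP Qw /eqP <-] /= ->.
Qed.

Lemma measurable_return_section o g :
  measurable [set omega | return_section o (X ^~ omega) = g].
Proof.
pose W n omega := mkseq (fun i => X i omega) n.
rewrite (_ : [set omega | _] = \bigcup_n
  ([set omega | gsection (word_prod (W n omega)) o = g] `&`
   [set omega | return_time o (X ^~ omega) = n])); last first.
  apply/seteqP; split => omega /=.
    move=> h; exists (return_time o (X ^~ omega)) => //; split => //.
    by rewrite /= word_prod_mkseq.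
  by move=> [n _ [/= <- hn]]; rewrite /return_section hn word_prod_mkseq.
have mr n : measurable [set omega | returns o (X ^~ omega) n].
  have := measurable_prefix (fun w => (0 < n)%N && (letter (word_prod w) o == o)) n.
  congr (measurable _); apply/seteqP; split=> omega /=;
  by rewrite word_prod_mkseq returnsE.
apply: bigcupT_measurable => n; apply: measurableI.
  exact: (measurable_prefix (fun w => gsection (word_prod w) o = g)).
(* For [n = 0] the event is that the walk never returns. *)
rewrite (_ : [set omega | _] =
   (\bigcap_(k in `I_n) ~` [set omega | returns o (X ^~ omega) k]) `&`
   (if n is 0 then \bigcap_k ~` [set omega | returns o (X ^~ omega) k]
    else [set omega | returns o (X ^~ omega) n])).
  apply: measurableI.
    by apply: fin_bigcap_measurable => // k _; exact/measurableC.
  case: n => [|n]; last exact: mr.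
  by apply: bigcapT_measurable => k; exact/measurableC.
apply/seteqP; split => omega /=.
  move=> /return_timeP[h1 h2]; split; first by move=> k kn; exact/negP/h1.
  by case: n {h1} h2 => [h2 k _|//]; exact/negP/h2.
move=> [h1 h2]; apply/return_timeP; split; first by move=> k kn; exact/negP/(h1 k kn).
by case: n {h1} h2 => [h2 k|//]; exact/negP/(h2 k I).
Qed.

End Process.

Local Open Scope ereal_scope.

(** The cylinders of first-return words are disjoint and lie in the event defining [law nu g].
    Finite families of them suffice for this inequality, so almost sure return need not be known
    yet. *)
Lemma hitting_le_ascension o (mu nu : probability G R) g :
  is_ascension o mu nu -> hitting (law mu) o o g <= law nu g.
Proof.
case=> d; case=> Omega; case=> P; case=> X; case=> indep ident push.
have Pcyl w : P (cylinder X w) = word_weight (law mu) w.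
  rewrite cylinderE indep//= /word_weight (big_nth 1%g).
  rewrite (perm_big (index_iota 0 (size w))); last first.
    apply: uniq_perm; [exact: fset_uniq|exact: iota_uniq|].
    by move=> i; rewrite !inE /index_iota subn0.
  by apply: eq_bigr => i _; exact: ident.
have -> : law nu g = P [set omega | return_section o (X ^~ omega) = g].
  exact: push.
apply: ge_ereal_sup => _ [D [Dfin Dsub] <-].
rewrite (_ : \sum_(w \in D) _ = \sum_(w \in D) P (cylinder X w)); last first.
  by apply: eq_fsbigr => w _; rewrite Pcyl.
rewrite -measure_fin_bigcup//.
- apply: le_measure; rewrite ?inE.
  + apply: fin_bigcup_measurable => // w _; exact: measurable_cylinder.
  + exact: measurable_return_section.
  + move=> omega [w /Dsub[hw sw] cw] /=.
    rewrite /return_section (hits_return hw cw).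
    by rewrite -word_prod_mkseq cw.
(* A path determines its return time, hence the length of the word, hence the word. *)
- move=> w w' /Dsub[hw _] /Dsub[hw' _] [omega [cw cw']].
  by rewrite -cw -(hits_return hw cw) (hits_return hw' cw') cw'.
- by move=> w _; exact: measurable_cylinder.
Qed.

Lemma weight_le_eq (p q : weight R G) : (forall g, p g <= q g) ->
  wmass p = 1 -> wmass q = 1 -> p = q.
Proof.
move=> pq p1 q1; apply: weight_ext => g; apply/eqP; rewrite eq_le pq/=.
have p0 := @weight_ge0 _ _ p; have q0 := @weight_ge0 _ _ q.
have split_ (r : weight R G) : wmass r = r g + \esum_(h in ~` [set g]) r h.
  rewrite /wmass (esumID [set g]) ?setTI; last by move=> h _; exact: weight_ge0.
  by rewrite esum_set1// weight_ge0.
have h : \esum_(h in ~` [set g]) p h <= \esum_(h in ~` [set g]) q h by exact: le_esum.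
have sf : \esum_(h in ~` [set g]) p h \is a fin_num.
  rewrite ge0_fin_numE; last by apply: esum_ge0.
  by apply: (@le_lt_trans _ _ 1); rewrite ?ltry// -p1 split_ leeDr.
rewrite -(leeD2rE _ _ sf) -split_ p1 -q1 split_.
by rewrite leeD2l.
Qed.

Lemma level_letter_transitive (mu : probability G R) :
  level_transitive (generated (supp mu)) -> letter_transitive (law mu).
Proof.
move=> tr x y; have [g hg gxy] := tr 1%N [tuple x] [tuple y].
by exists g => //; move: gxy; rewrite /= act_letter => -[].
Qed.

Section Transitive.
Variables (mu nu : probability G R) (o : 'I_m).
Hypothesis asc : is_ascension o mu nu.
Hypothesis tr : level_transitive (generated (supp mu)).

Let p1 : wmass (law mu) = 1. Proof. exact: wmass_law. Qed.
Let ptrans : letter_transitive (law mu).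
Proof. exact: level_letter_transitive. Qed.

Let ho : wmass (hitting (law mu) o o) <= 1.
Proof.
rewrite -(wmass_law nu); apply: le_esum => g _; exact: hitting_le_ascension asc.
Qed.

Lemma wmass_hitting_ascension y : wmass (hitting (law mu) o y) = 1.
Proof. exact: wmass_hitting. Qed.

Lemma hitting_ascension : hitting (law mu) o o = law nu.
Proof.
apply: weight_le_eq; [|exact: wmass_hitting_ascension|exact: wmass_law].
by move=> g; exact: hitting_le_ascension asc.
Qed.

(* Schreier generators of the stabilizer of [o]: [c y] and [d y] are sections
   along paths from [y] to [o] and from [o] to [y]. *)
Lemma level_transitive_ascension : level_transitive (generated (supp nu)).
Proof.
pose F := hitting (law mu) o.
have [s1 sV] := generated_subgroup (supp nu).
have supF g : F o g != 0 -> generated (supp nu) g.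
  rewrite /F hitting_ascension => hg.
  by apply: (@sub_gen_smallest _ (@is_subgroup _) (supp nu)).
have /boolp.choice[c hc] y : exists c, (y = o -> c = 1%g) /\ (y != o -> F y c != 0).
  have [->|yo] := eqVneq y o; first by exists 1%g.
  have [c hc] := wmass1_neq0 (wmass_hitting_ascension y).
  by exists c; split=> // /eqP; rewrite (negbTE yo).
have mulN0 (a b : \bar R) : a != 0 -> b != 0 -> a * b != 0.
  by move=> a0 b0; rewrite mule_eq0 negb_or a0.
have gt0N (p : weight R G) g : p g != 0 -> 0 < p g.
  by move=> pg; rewrite lt_neqAle eq_sym pg weight_ge0.
have leN0 (a b : \bar R) : 0 <= a -> a <= b -> a != 0 -> b != 0.
  by move=> a0 ab aN0; rewrite gt_eqF// (lt_le_trans _ ab)// lt_neqAle eq_sym aN0.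
(* Such a [d] is the section along a path from [o] whose continuation by a first passage from [y] is
   a first return; it is reset to 1 whenever the path comes back to [o]. *)
have hd0 y : exists d, forall g, F y g != 0 -> F o (d * g)%g != 0.
  apply: (stable_letters (x := o) (Q := fun y => exists d, forall g,
    F y g != 0 -> F o (d * g)%g != 0) ptrans).
    by exists 1%g => g; rewrite mul1g.
  move=> {}y s [d hd] ps; have [->|so] := eqVneq (letter s y) o.
    by exists 1%g => g; rewrite mul1g.
  exists (d * gsection s y)%g => g Fg; rewrite -mulgA; apply: hd.
  apply: leN0 (hitting_step_next (law mu) g so) _; last exact: mulN0.
  by rewrite mule_ge0 ?weight_ge0.
have /boolp.choice[d hd] y : exists d, (y = o -> d = 1%g) /\
    forall g, F y g != 0 -> F o (d * g)%g != 0.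
  have [->|yo] := eqVneq y o; first by exists 1%g; split=> // g; rewrite mul1g.
  by have [d hd] := hd0 y; exists d; split=> // /eqP; rewrite (negbTE yo).
(* The paths [c] turn a section from [y] to [letter g y] into one from [o] to [o]. In products the
   intermediate [c] cancel, so [K] is a subgroup. *)
pose K : set G := [set g | forall y,
  generated (supp nu) ((c y)^-1 * gsection g y * c (letter g y))%g].
have Ksub : is_subgroup K.
  split=> [y|a b Ka Kb y]; first by rewrite gsection1 mulg1 mulVg.
  set z := letter a y; set u := letter b^-1%g z.
  have bu : letter b u = z by rewrite /u -letterM mulVg letter1.
  have sb : gsection b^-1%g z = (gsection b u)^-1%g.
    by apply: (mulIg (gsection b u)); rewrite -gsectionM mulVg gsection1 mulVg.
  have := sV _ _ (Ka y) (Kb u); rewrite bu -/z letterM -/z -/u gsectionM -/z sb.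
  by rewrite !invgM !invgK !mulgA mulgK.
have sK : supp mu `<=` K.
  move=> s ps y; set z := letter s y.
  have ps0 : 0 <= law mu s by exact: weight_ge0.
  have dc : generated (supp nu) (d y * c y)%g.
    have [yo|yo] := eqVneq y o.
      by rewrite (hd y).1// (hc y).1// mulg1.
    by apply: supF; apply: (hd y).2; exact: (hc y).2.
  have dsc : generated (supp nu) (d y * (gsection s y * c z))%g.
    apply: supF; apply: (hd y).2; have [zo|zo] := eqVneq z o.
      rewrite (hc z).1// mulg1.
      exact: leN0 (hitting_step_last (law mu) zo) ps.
    apply: leN0 (hitting_step_next (law mu) (c z) zo) _.
      by rewrite mule_ge0 ?weight_ge0.
    by apply: mulN0 => //; exact: (hc z).2.
  have sVinv a : generated (supp nu) a -> generated (supp nu) a^-1%g.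
    by move=> ha; rewrite -[(a^-1)%g]mul1g; exact: sV.
  (* The element sought is the inverse of [d y * c y] times [d y * (gsection s y * c z)]; both are
     in the subgroup generated by the support of [nu]. *)
  have := sV _ _ (sVinv _ dc) (sVinv _ dsc).
  by rewrite invgK invgM -mulgA mulKg mulgA.
(* Transitivity is used one level higher: an element sending [o :: u] to [o :: v] fixes [o], its
   section there sends [u] to [v], and [K] applies with [c o = 1]. *)
move=> n u v.
have [g hg guv] := tr [tuple of o :: u] [tuple of o :: v].
move: guv; rewrite /= act_cons => -[go gu].
exists (gsection g o) => //.
have := hg K (conj Ksub sK) o.
by rewrite go (hc o).1// invg1 mul1g mulg1.
Qed.

End Transitive.

End AscensionLaw.

(** * The walk prolonged to the end of a block *)

Section WeightEntropy.
Context {R : realType} {G : groupType}.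
Implicit Types p q : weight R G.

Lemma wmass_leDl p q : (wmass p <= wmass (p + q)%R)%E.
Proof. by rewrite wmassD leeDl// wmass_ge0. Qed.

Lemma wmass_leDr p q : (wmass q <= wmass (p + q)%R)%E.
Proof. by rewrite wmassD leeDr// wmass_ge0. Qed.

Lemma wmass_muln p n : wmass (p *+ n) = (n%:R%:E * wmass p)%E.
Proof.
elim: n => [|n ih]; first by rewrite mulr0n wmass0 mul0e.
by rewrite mulrS wmassD ih -nat1r EFinD ge0_muleDl ?lee_fin// mul1e.
Qed.

Lemma entropy_weightD p q : (wmass (p + q)%R <= 1)%E ->
  (entropy (p + q)%R <= entropy p + entropy q)%E.
Proof.
by move=> h; apply: entropyD; [exact: (subprob_weight h)|exact: weight_ge0..].
Qed.

Lemma entropy_weight_sum (I : Type) (s : seq I) (P : pred I)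
    (f : I -> weight R G) : (wmass (\sum_(i <- s | P i) f i)%R <= 1)%E ->
  (entropy (\sum_(i <- s | P i) f i)%R <= \sum_(i <- s | P i) entropy (f i))%E.
Proof.
elim: s => [|i s ih].
  rewrite !big_nil => _; rewrite /entropy esum1// => g _.
  by rewrite /entropy_term/= mul0r oppr0.
rewrite !big_cons; case: ifP => // _ h.
apply: le_trans (entropy_weightD h) _; rewrite leeD2l// ih//.
exact: le_trans (wmass_leDr _ _) h.
Qed.

End WeightEntropy.

Section Chain.
Context {R : realType} {m : nat} {A : automaton m}.
Local Notation G := (autgroup A).
Local Notation wt := (weight R G).
Variables (p : wt) (o : 'I_m) (hit : 'I_m -> wt) (r' : nat).
Hypothesis p1 : wmass p = 1%E.
Hypothesis hit1 : forall y, wmass (hit y) = 1%E.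
Hypothesis hit_rec : forall y,
  hit y = wreath p y o + \sum_(z | z != o) wreath p y z * hit z.
Local Notation L := (wreath p).
Local Notation kap := (hit o).
Local Notation r := r'.+1.

(* [chain x t y c] is the law of the section at [x] of the [t]-th step of the
   walk, on the event that it has moved [x] to [y] and that [c] visits to [o]
   are still missing before the one that ends the current block of [r] visits. *)
Fixpoint chain (x : 'I_m) (t : nat) (y : 'I_m) (c : nat) : wt :=
  if t is t'.+1 then
    \sum_z chain x t' z (if y == o then c.+1 %% r else c)%N * L z y
  else if (y == x) && (c == r') then 1 else 0.

(* The section at [x] of the walk run until the end of the first block that is
   unfinished at time [t]. *)
Definition stopped x t : wt :=
  \sum_y \sum_(c < r) chain x t y c * hit y * kap ^+ c.

Definition ending x t : wt := \sum_y chain x t y 0 * L y o.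

Definition ongoing x t : wt :=
  \sum_y (\sum_(c < r') chain x t y c.+1 * hit y * kap ^+ c.+1 +
          chain x t y 0 * \sum_(z | z != o) L y z * hit z).

(** The counter moves by a cyclic permutation at each visit to [o] and is otherwise constant, so
    summing over it forgets it. *)
Lemma sum_chain x t y : \sum_(c < r) chain x t y c = wreath (p ^+ t) x y.
Proof.
elim: t y => [|t ih] y /=.
  rewrite expr0 wreath1 mxE big_ord_recr/= eqxx andbT eq_sym.
  rewrite big1 ?add0r => [|c _]; first by case: eqP.
  by rewrite (ltn_eqF (ltn_ord c)) andbF.
rewrite exprSr wreathM mxE exchange_big/=; apply: eq_bigr => z _.
rewrite -mulr_suml -ih; congr (_ * _); case: (y == o) => //.
rewrite big_ord_recr big_ord_recl /= modnn addrC; congr (_ + _).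
by apply: eq_bigr => c _; rewrite modn_small// ltnS.
Qed.

(** Only states with counter 0 can end a block at the next step; for these, [hit_rec] separates the
    step to [o] from the others. *)
Lemma stoppedE x t : stopped x t = ending x t + ongoing x t.
Proof.
rewrite /stopped /ending /ongoing -big_split/=; apply: eq_bigr => y _.
rewrite big_ord_recl /= expr0 mulr1 {1}hit_rec mulrDr -addrA; congr (_ + _).
by rewrite addrC.
Qed.

(** An ending step leaves the walk at [o] with counter [r'], whose prolongation is
    [kap * kap ^+ r']. Any other step only carries out the beginning of the prolongation already
    counted. *)
Lemma stoppedS x t : stopped x t.+1 = ongoing x t + ending x t * kap ^+ r.
Proof.
rewrite /stopped /ongoing /ending mulr_suml -big_split/=.
under eq_bigr do under eq_bigr do rewrite !mulr_suml.
under eq_bigr do rewrite exchange_big/=.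
rewrite exchange_big/=; apply: eq_bigr => y _.
rewrite (bigD1 o)//= eqxx big_ord_recr/= modnn.
under [X in _ + X]eq_bigr => z zo do rewrite (negbTE zo).
rewrite [X in _ + X]exchange_big/= [X in _ + X]big_ord_recl/=.
have E1 : \sum_(c < r') chain x t y (c.+1 %% r) * L y o * kap * kap ^+ c =
    \sum_(c < r') chain x t y c.+1 * L y o * kap ^+ c.+1.
  by apply: eq_bigr => c _; rewrite modn_small ?ltnS// exprS !mulrA.
rewrite E1 -!mulrA -exprS !mulrA.
(* With a positive counter, the first step of the prolongation may reach [o] without ending the
   block. *)
have E2 : \sum_(c < r') chain x t y c.+1 * hit y * kap ^+ c.+1 =
   \sum_(c < r') chain x t y c.+1 * L y o * kap ^+ c.+1 +
   \sum_(c < r') \sum_(z | z != o)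
      chain x t y c.+1 * L y z * hit z * kap ^+ c.+1.
  rewrite -big_split/=; apply: eq_bigr => c _.
  rewrite {1}hit_rec mulrDr mulrDl mulr_sumr mulr_suml; congr (_ + _).
  by apply: eq_bigr => z _; rewrite !mulrA.
rewrite E2 mulr_sumr.
under [X in _ + (X + _)]eq_bigr do rewrite mulr1 -mulrA.
rewrite -!addrA; congr (_ + _).
by rewrite addrC [X in X + _ = _]addrC -addrA.
Qed.

Local Open Scope ereal_scope.

Lemma wmass_chain x t : \sum_y \sum_(c < r) wmass (chain x t y c) = 1.
Proof.
under eq_bigr do rewrite -wmass_sum sum_chain.
by rewrite sum_wmass_wreath wmassX1.
Qed.

Lemma wmass_stopped x t : wmass (stopped x t) = 1.
Proof.
rewrite -(wmass_chain x t) wmass_sum; apply: eq_bigr => y _.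
rewrite wmass_sum; apply: eq_bigr => c _.
by rewrite !wmassM hit1 wmassX1// !mule1.
Qed.

Lemma wmass_ending x t : wmass (ending x t) <= 1.
Proof. by rewrite -(wmass_stopped x t) stoppedE wmass_leDl. Qed.

Lemma wmass_ongoing x t : wmass (ongoing x t) <= 1.
Proof. by rewrite -(wmass_stopped x t) stoppedE wmass_leDr. Qed.

(** Consecutive laws share the part [ongoing x t]. The ending part pays [entropy (kap ^+ r)] in
    proportion to its mass, and [entropy_split] reassembles the two parts of [stopped x t]. *)
Lemma entropy_stoppedS x t (s : R) : (0 < s < 1)%R ->
  entropy (stopped x t.+1) <= entropy (stopped x t) +
    (wmass (ending x t) * (entropy (kap ^+ r)%R + (- ln s)%:E) +
     (- ln (1 - s))%:E).
Proof.
move=> s01; have /andP[s0 s1] := s01.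
have l1 : 0 <= (- ln (1 - s))%:E by rewrite lee_fin oppr_ge0 ln_le0// gerBl ltW.
have l0 : 0 <= (- ln s)%:E by rewrite lee_fin oppr_ge0 ln_le0// ltW.
have kr1 : wmass (kap ^+ r)%R = 1 by rewrite wmassX1.
have Hk : 0 <= entropy (kap ^+ r)%R.
  by apply/entropy_ge0/subprob_weight; rewrite kr1.
rewrite stoppedS; apply: le_trans (entropy_weightD _) _.
  by rewrite -stoppedS wmass_stopped.
apply: (@le_trans _ _ (entropy (ongoing x t) +
  (wmass (ending x t) * entropy (kap ^+ r)%R + entropy (ending x t)))).
  rewrite leeD2l//; apply: le_trans (entropyM_le (wmass_ending x t) _) _.
    by rewrite kr1.
  by rewrite kr1 mul1e.
rewrite addeCA addeA -addeA [entropy (ongoing _ _) + _]addeC.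
have := @entropy_split _ _ (ending x t) (ongoing x t) s.
have -> : (fun g => ending x t g + ongoing x t g) = stopped x t.
  by rewrite stoppedE.
move=> /(_ (subprob_weight _) (@weight_ge0 _ _ _) (@weight_ge0 _ _ _) s01).
rewrite wmass_stopped lexx => /(_ isT) h.
apply: le_trans (leeD2l _ h) _.
rewrite addeCA leeD2l// ge0_muleDr// -addeA leeD2l// leeD2l//.
by rewrite -[leRHS]mul1e lee_wpmul2r// wmass_ongoing.
Qed.

Lemma entropy_stopped x n (s : R) : (0 < s < 1)%R ->
  entropy (stopped x n) <= entropy (stopped x 0) +
    ((\sum_(t < n) wmass (ending x t)) * (entropy (kap ^+ r)%R + (- ln s)%:E) +
     (n%:R * - ln (1 - s))%:E).
Proof.
move=> s01; elim: n => [|n ih]; first by rewrite big_ord0 mul0e mul0r !adde0.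
apply: le_trans (entropy_stoppedS _ _ s01) _.
apply: le_trans (leeD2r _ ih) _.
rewrite -addeA leeD2l// big_ord_recr/= ge0_muleDl ?wmass_ge0//; last first.
  by apply: sume_ge0 => t _; exact: wmass_ge0.
rewrite -nat1r mulrDl mul1r EFinD -!addeA leeD2l//.
by rewrite addeC -addeA leeD2l// addeC.
Qed.

(** Prolonging is right multiplication by a probability and cannot lower the entropy; [m * r] counts
    the pairs of letter and counter that [stopped] forgets. *)
Lemma entropy_chain_le x t :
  \sum_y entropy (wreath (p ^+ t)%R x y) <=
  entropy (stopped x t) + (ln (m * r)%:R)%:E.
Proof.
have -> : (m * r)%N = #|{: 'I_m * 'I_r}| by rewrite card_prod !card_ord.
have ys_sub y : wmass (\sum_(c < r) chain x t y c)%R <= 1.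
  rewrite -(wmass_chain x t) wmass_sum [leRHS](bigD1 y)//= leeDl//.
  by apply: sume_ge0 => z _; apply: sume_ge0 => c _; exact: wmass_ge0.
have yc_sub y (c : 'I_r) : wmass (chain x t y c) <= 1.
  apply: le_trans (ys_sub y); rewrite wmass_sum (bigD1 c)//= leeDl//.
  by apply: sume_ge0 => z _; exact: wmass_ge0.
pose q (u : 'I_m * 'I_r) := (chain x t u.1 u.2 * hit u.1 * kap ^+ u.2)%R.
have qE : (fun g => \sum_u q u g) = stopped x t.
  apply/funext => g; rewrite -weight_sumE; congr (weight_fun _ g).
  by rewrite /stopped pair_big.
have := sum_entropy_le (p := q) (fun u => @weight_ge0 _ _ (q u)).
rewrite qE => /(_ (subprob_weight _)); rewrite wmass_stopped lexx => /(_ isT).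
apply: le_trans; rewrite /q -(pair_big xpredT xpredT
  (fun y (c : 'I_r) => entropy (chain x t y c * hit y * kap ^+ c)%R)).
apply: lee_sum => y _; rewrite -sum_chain.
apply: le_trans (entropy_weight_sum (ys_sub y)) _.
apply: lee_sum => c _; rewrite -mulrA; apply: entropy_leM => //.
by rewrite wmassM hit1 wmassX1// mule1.
Qed.

(** Its mass is the expected number of visits already made in the current block. Multiples in the
    semiring make the balance below an identity of weights. *)
Definition progress x t : wt :=
  (\sum_y \sum_(c < r) chain x t y c *+ (r' - c))%R.

(** A visit to [o] adds one to the count, and an ending visit also removes a whole block of [r]. *)
Lemma progressS x t : (progress x t.+1 + ending x t *+ r =
  \sum_y \sum_z \sum_(c < r) chain x t y c * L y z *+ (r' - c) +
  wreath (p ^+ t.+1) x o)%R.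
Proof.
rewrite /progress /ending exprSr wreathM mxE -sumrMnl.
under eq_bigr do under eq_bigr do rewrite -sumrMnl.
under eq_bigr do rewrite exchange_big/=.
rewrite exchange_big/= -!big_split/=; apply: eq_bigr => y _.
rewrite (bigD1 o)//= [in RHS](bigD1 o)//= eqxx -!addrA.
rewrite [X in (_ + X = _)%R]addrC [X in (_ = _ + X)%R]addrC !addrA.
congr (_ + _)%R; last by apply: eq_bigr => z zo; rewrite (negbTE zo).
rewrite -sum_chain mulr_suml -big_split/= big_ord_recr/= modnn subnn mulr0n addr0.
rewrite [RHS]big_ord_recl/= subn0 -mulrSr addrC; congr (_ + _)%R.
apply: eq_bigr => c _; rewrite modn_small ?ltnS// -mulrSr.
by rewrite /bump/= add1n subnSK.
Qed.

Lemma wmass_progress x n :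
  wmass (progress x n) + r%:R%:E * \sum_(t < n) wmass (ending x t) =
  \sum_(t < n) wmass (wreath (p ^+ t.+1)%R x o).
Proof.
elim: n => [|n ih].
  rewrite !big_ord0 mule0 adde0 /progress big1 ?wmass0// => y _.
  rewrite big1// => c _ /=; case: (y == x) => /=; last by rewrite mul0rn.
  by case: eqP => [->|]; rewrite ?subnn ?mulr0n ?mul0rn.
rewrite [RHS]big_ord_recr/= -ih big_ord_recr/= ge0_muleDr ?wmass_ge0//; last first.
  by apply: sume_ge0 => t _; exact: wmass_ge0.
rewrite -[RHS]/(_ + _) addeCA -wmass_muln -wmassD progressS wmassD.
rewrite addeA; congr (_ + _); rewrite addeC; congr (_ + _).
rewrite /progress !wmass_sum; apply: eq_bigr => y _.
rewrite exchange_big/= !wmass_sum; apply: eq_bigr => c _.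
rewrite (_ : \sum_(z < m) _ = (chain x n y c * \sum_z L y z) *+ (r' - c))%R.
  rewrite !wmass_muln; congr (_ * _).
  by rewrite wmassM wmass_sum sum_wmass_wreath p1 mule1.
by rewrite sumrMnl mulr_sumr.
Qed.

Lemma sum_wmass_ending n :
  r%:R%:E * (\sum_x \sum_(t < n) wmass (ending x t)) <= n%:R%:E.
Proof.
rewrite ge0_sume_distrr; last first.
  by move=> x _; apply: sume_ge0 => t _; exact: wmass_ge0.
apply: (@le_trans _ _ (\sum_x \sum_(t < n) wmass (wreath (p ^+ t.+1)%R x o))).
  by apply: lee_sum => x _; rewrite -wmass_progress leeDr// wmass_ge0.
rewrite exchange_big/= (eq_bigr (fun=> 1)); last first.
  by move=> t _; rewrite sum_wmass_wreath_col wmassX1.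
by rewrite sumEFin sumr_const card_ord.
Qed.

Lemma entropy_walk_le n (s : R) : (0 < s < 1)%R ->
  entropy (p ^+ n)%R <=
  \sum_x (entropy (stopped x 0) + (ln (m * r)%:R)%:E) +
  ((n%:R / r%:R)%:E * (entropy (kap ^+ r)%R + (- ln s)%:E) +
   (m%:R * (n%:R * - ln (1 - s)))%:E).
Proof.
move=> s01; have /andP[s0 s1] := s01.
have l0 : 0 <= (- ln s)%:E by rewrite lee_fin oppr_ge0 ln_le0// ltW.
have kr1 : wmass (kap ^+ r)%R = 1 by rewrite wmassX1.
have Hk : 0 <= entropy (kap ^+ r)%R + (- ln s)%:E.
  by rewrite adde_ge0//; apply/entropy_ge0/subprob_weight; rewrite kr1.
apply: le_trans (entropy_wreath_le (wmassX1 n p1)) _.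
apply: (@le_trans _ _ (\sum_x ((entropy (stopped x 0) + (ln (m * r)%:R)%:E) +
   ((\sum_(t < n) wmass (ending x t)) * (entropy (kap ^+ r)%R + (- ln s)%:E) +
     (n%:R * - ln (1 - s))%:E)))).
  apply: lee_sum => x _; apply: le_trans (entropy_chain_le x n) _.
  by rewrite addeAC; apply: leeD2r; exact: entropy_stopped.
rewrite big_split/= leeD2l// big_split/= -ge0_sume_distrl; last first.
  by move=> x _; apply: sume_ge0 => t _; exact: wmass_ge0.
apply: leeD.
  apply: lee_wpmul2r => //; rewrite EFinM lee_pdivlMr ?ltr0n// muleC.
  exact: sum_wmass_ending.
by rewrite sumEFin sumr_const card_ord lee_fin -[leLHS]mulr_natl.
Qed.

End Chain.

Lemma slope_le (R : realType) (a b C : R) (N : nat) :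
  (forall n, (N <= n)%N -> n%:R * a <= C + n%:R * b) -> a <= b.
Proof.
move=> h; rewrite leNgt; apply/negP => ba.
have ab0 : 0 < a - b by rewrite subr_gt0.
pose n := maxn N (Num.bound (C / (a - b))).
have := h n (leq_maxl _ _); apply/negP; rewrite -ltNge -ltrBrDr -mulrBr.
rewrite -ltr_pdivrMr//; apply: le_lt_trans (ler_norm _) _.
apply: lt_le_trans (archi_boundP (normr_ge0 _)) _.
rewrite ler_nat; apply: leq_trans (leq_maxr N _); rewrite leq_eqVlt; apply/orP; left.
by rewrite /Num.bound normr_id.
Qed.

(** * Asymptotic entropy of a law and of its ascension *)

Section AscensionEntropy.
Context {R : realType} {m : nat} {A : automaton m}.
Variables (mu nu : probability (autgroup A) R) (o : 'I_m).
Hypothesis asc : is_ascension o mu nu.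
Hypothesis tr : level_transitive (generated (supp mu)).
Hypothesis Hmu : (entropy (law mu) < +oo)%E.
Hypothesis Hnu : (entropy (law nu) < +oo)%E.

Let hit := hitting (law mu) o.

Lemma stopped0 r' x : stopped (law mu) o hit r' x 0 = hit x * hit o ^+ r'.
Proof.
rewrite /stopped (bigD1 x)//= [X in _ + X]big1 => [|y yx]; last first.
  by rewrite big1// => c _; rewrite (negbTE yx) mul0r mul0r.
rewrite addr0 (bigD1 ord_max)//= !eqxx mul1r big1 ?addr0// => c cr.
by rewrite (_ : (c == r' :> nat) = false) ?mul0r//; apply: contra_neqF cr => /eqP h; exact: val_inj.
Qed.

Lemma entropy_stopped0_lty r' x :
  (entropy (stopped (law mu) o hit r' x 0) < +oo)%E.
Proof.
have ptr := level_letter_transitive tr.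
have h1 y : wmass (hit y) = 1%E by exact: (wmass_hitting_ascension asc tr).
have ho : hit o = law nu by exact: (hitting_ascension asc tr).
rewrite stopped0; apply: le_lt_trans (entropyM_leD _ _) _; rewrite ?wmassX1 ?h1//.
rewrite lte_add_pinfty//; last by apply: entropyX_lty => //; rewrite ho.
apply: entropy_hitting_lty => //; first exact: wmass_law.
  by rewrite h1.
by rewrite -/hit ho.
Qed.

Lemma asymptotic_entropy_ascension :
  (asymptotic_entropy (law mu) <= asymptotic_entropy (law nu))%E.
Proof.
have h1 y : wmass (hit y) = 1%E by exact: (wmass_hitting_ascension asc tr).
have ho : hit o = law nu by exact: (hitting_ascension asc tr).
have [lm [-> lmn _]] := asymptotic_entropyP (wmass_law mu) Hmu.
have [ln_ [-> _ lnn]] := asymptotic_entropyP (wmass_law nu) Hnu.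
rewrite lee_fin.
have hE r : entropy (law nu ^+ r) = (fine (entropy (law nu ^+ r)))%:E.
  symmetry; apply: fineK; rewrite ge0_fin_numE.
    by apply: entropyX_lty => //; exact: wmass_law.
  by apply/entropy_ge0/subprob_weight; rewrite wmassX1 ?wmass_law.
(* Here [n] tends to infinity with [r] and [s] fixed, which removes the finite constant [C]; after
   multiplication by [r], the term [- ln s] stands without that factor. *)
have key r' (s : R) : 0 < s < 1 -> r'.+1%:R * lm <=
    (fine (entropy (law nu ^+ r'.+1)) - ln s) + r'.+1%:R * (m%:R * - ln (1 - s)).
  move=> s01; set h := fine _.
  pose C := fine (\sum_x (entropy (stopped (law mu) o hit r' x 0) +
     (ln (m * r'.+1)%:R)%:E))%E.
  have CE : (\sum_x (entropy (stopped (law mu) o hit r' x 0) +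
     (ln (m * r'.+1)%:R)%:E))%E = C%:E.
    rewrite fineK//; apply/sum_fin_numP => x _ _.
    rewrite fin_numD/= andbT ge0_fin_numE ?entropy_stopped0_lty//.
    by apply/entropy_ge0/subprob_weight; rewrite wmass_stopped ?wmass_law.
  have : lm <= (h - ln s) / r'.+1%:R + m%:R * - ln (1 - s).
    apply: (@slope_le _ _ _ C 0) => n _; rewrite -lee_fin.
    apply: le_trans (lmn n) _.
    have := entropy_walk_le r' (wmass_law mu) h1 (hitting_rec (law mu) o) n s01.
    move=> /le_trans; apply; rewrite CE -/hit ho hE -/h.
    rewrite -[leLHS]/((C + (n%:R / r'.+1%:R * (h - ln s) +
      m%:R * (n%:R * - ln (1 - s))))%:E) lee_fin lerD2l.
    by rewrite le_eqVlt; apply/orP; left; apply/eqP; ring.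
  rewrite -(ler_pM2l (ltr0Sn R r')) mulrDr => /le_trans; apply.
  by rewrite mulrCA mulfV ?mulr1// pnatr_eq0.
apply/ler_addgt0Pr => e e0.
(* Chosen so that [s <= 1 / 2] and [2 * m * s <= e / 2]; then [- ln (1 - s) <= 2 * s] bounds the
   cost per step by [e / 2]. *)
pose s : R := e / (4 * (m%:R + 1 + e)).
have m0 : 0 <= m%:R :> R by [].
have den0 : 0 < 4 * (m%:R + 1 + e) by lra.
have s0 : 0 < s by rewrite divr_gt0.
have s2 : s <= 1 / 2 by rewrite ler_pdivrMr//; lra.
have lns : - ln (1 - s) <= 2 * s.
  have q0 : 0 < 1 - s by lra.
  have : - ln (1 - s) = ln (1 + s / (1 - s)).
    by rewrite -lnV ?posrE//; congr ln; field; rewrite gt_eqF.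
  move=> ->; apply: (@le_trans _ _ (s / (1 - s))).
    by apply: le_ln1Dx; rewrite (lt_le_trans (ltrN10 R))// divr_ge0// ltW.
  by rewrite ler_pdivrMr//; clearbody s; nra.
have ms : m%:R * - ln (1 - s) <= e / 2.
  apply: le_trans (ler_wpM2l m0 lns) _.
  rewrite /s mulrA mulrA ler_pdivrMr//; nra.
have [N hN] := lnn (e / 2) (divr_gt0 e0 (ltr0n R 2)).
suff h : lm <= ln_ + e / 2 + m%:R * - ln (1 - s) by lra.
(* With [s] fixed, [- ln s] does not grow with [r]. Starting at [N.+1] excludes [r = 0]. *)
apply: (@slope_le _ _ _ (- ln s) N.+1) => -[//|r'] Nr.
have s01 : 0 < s < 1 by rewrite s0/=; lra.
apply: le_trans (key r' s s01) _.
have := hN r'.+1 (ltnW Nr); rewrite hE lee_fin; lra.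
Qed.

End AscensionEntropy.

(** * Limits of entropy-tight sequences *)

Section RealLimits.
Context {R : realType}.

(** The tangent at a fixed point is affine, hence continuous, and bounds [eta] from above. *)
Lemma eta_cvg_le (a : nat -> R) (b e : R) : (forall j, 0 <= a j) -> 0 <= b ->
  a @ \oo --> b -> 0 < e -> \forall j \near \oo, eta (a j) <= eta b + e.
Proof.
move=> a0 b0 ab e0.
(* At [b = 0] there is no finite tangent slope; the tangent at [e / 2] has value [e / 2] at 0. *)
pose c := if b == 0 then e / 2 else b.
have c0 : 0 < c.
  by rewrite /c; case: eqVneq => [_|bN0]; rewrite ?divr_gt0// lt_neqAle eq_sym bN0.
have lim : (fun j => - (a j * ln c) + (c - a j)) @ \oo --> - (b * ln c) + (c - b).
  apply: cvgD; first by apply: cvgN; apply: cvgMl.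
  by apply: cvgB => //; exact: cvg_cst.
have cb : - (b * ln c) + (c - b) < eta b + e.
  rewrite /c /eta; case: eqVneq => [->|_]; last by rewrite subrr ltrD2l.
  by rewrite !mul0r; lra.
have := cvgr_lt _ lim _ cb => /(_ _) near1.
by apply: filterS near1 => j /ltW; apply: le_trans; exact: gibbs.
Qed.

Lemma sum_eta_cvg_le (T : Type) (s : seq T) (a : nat -> T -> R) (b : T -> R)
    (e : R) : (forall j h, 0 <= a j h) -> (forall h, 0 <= b h) ->
  (forall h, a ^~ h @ \oo --> b h) -> 0 < e ->
  \forall j \near \oo, \sum_(h <- s) eta (a j h) <= \sum_(h <- s) eta (b h) + e.
Proof.
move=> a0 b0 ab; elim: s e => [|h s ih] e e0.
  by apply: nearW => j; rewrite !big_nil add0r ltW.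
have e2 : 0 < e / 2 by rewrite divr_gt0.
apply: filterS2 (ih _ e2) (eta_cvg_le (fun j => a0 j h) (b0 h) (ab h) e2) => j h1 h2.
rewrite !big_cons; lra.
Qed.

Lemma cvg_sum_seq (T : Type) (s : seq T) (a : nat -> T -> R) (b : T -> R) :
  (forall h, a ^~ h @ \oo --> b h) ->
  (fun j => \sum_(h <- s) a j h) @ \oo --> \sum_(h <- s) b h.
Proof.
move=> ab; elim: s => [|h s ih].
  by rewrite big_nil; under eq_fun do rewrite big_nil; exact: cvg_cst.
by rewrite big_cons; under eq_fun do rewrite big_cons; exact: cvgD.
Qed.

End RealLimits.

Section WeightLimits.
Context {R : realType} {G : groupType}.
Implicit Types (p q : weight R G) (D K : set G).
Local Open Scope ereal_scope.

Lemma weight_fin p : wmass p <= 1 -> forall g, p g \is a fin_num.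
Proof. by move=> p1 g; apply: subprob_fin; exact: subprob_weight. Qed.

Fact restrict_ge0 D p g : 0 <= (fun g => if g \in D then p g else 0) g.
Proof. by rewrite /=; case: ifP => // _; exact: weight_ge0. Qed.
Definition restrict D p := Weight (restrict_ge0 D p).

Lemma restrict_split D p : p = (restrict D p + restrict (~` D) p)%R.
Proof.
apply: weight_ext => g; rewrite weightD /= in_setC.
by case: (g \in D); rewrite ?adde0 ?add0e.
Qed.

Lemma wmass_restrict D p : wmass (restrict D p) = \esum_(g in D) p g.
Proof. by rewrite [RHS]esum_mkcond. Qed.

Lemma wmass_restrict_le D p : wmass (restrict D p) <= wmass p.
Proof. by rewrite {2}(restrict_split D p) wmass_leDl. Qed.

Lemma entropy_restrict D p :
  entropy (restrict D p) = \esum_(g in D) entropy_term p g.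
Proof.
rewrite [RHS]esum_mkcond; apply: eq_esum => g _; rewrite /entropy_term /=.
by case: ifP => // _; rewrite mul0r oppr0.
Qed.

Lemma entropy_term_ge0 p : wmass p <= 1 -> forall g, 0 <= entropy_term p g.
Proof. by move=> p1; apply: eeta_subprob_ge0; exact: subprob_weight. Qed.

Lemma entropy_restrict_le D p : wmass p <= 1 ->
  entropy (restrict D p) <= entropy p.
Proof.
by move=> p1; rewrite entropy_restrict; apply: subset_esum => //; exact: entropy_term_ge0.
Qed.

Section Tail.
Variables (p q : weight R G) (K K' : set G).
Hypotheses (p1 : wmass p = 1) (q1 : wmass q = 1).

Let KK := [set (k * k')%g | k in K & k' in K'].

(** The product of the two restrictions lives on [KK]; outside it only these terms contribute. *)
Let rest := (restrict K p * restrict (~` K') q + restrict (~` K) p * q)%R.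

Let mul_split : (p * q = restrict K p * restrict K' q + rest)%R.
Proof.
by rewrite /rest addrA -mulrDr -restrict_split -mulrDl -restrict_split.
Qed.

Let mul_rest g : ~ KK g -> (p * q)%R g = rest g.
Proof.
move=> gK; rewrite mul_split weightD [X in X + _](_ : _ = 0) ?add0e//.
rewrite weightM; apply: esum1 => h _ /=.
case: ifPn => [|_]; last by rewrite mul0e.
rewrite inE => Kh; case: ifPn => [|_]; last by rewrite mule0.
rewrite inE => Kg; exfalso; apply: gK; exists h => //; exists (h^-1 * g)%g => //.
by rewrite mulVKg.
Qed.

Let rest1 : wmass rest <= 1.
Proof. by rewrite -[leRHS]mule1 -{1}p1 -q1 -wmassM mul_split wmass_leDr. Qed.

Lemma wmass_mul_tail : \esum_(g in ~` KK) (p * q)%R g <=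
  \esum_(g in ~` K) p g + \esum_(g in ~` K') q g.
Proof.
apply: (@le_trans _ _ (wmass rest)).
  apply: (@le_trans _ _ (\esum_(g in ~` KK) rest g)).
    by apply: le_esum => g /mul_rest ->.
  by apply: subset_esum => //; exact: weight_ge0.
rewrite /rest wmassD !wmassM -!wmass_restrict q1 mule1 addeC.
apply: leeD2r.
by rewrite -[leRHS]mul1e lee_wpmul2r ?wmass_ge0// -p1 wmass_restrict_le.
Qed.

Lemma entropy_mul_tail :
  \esum_(g in ~` KK) entropy_term (p * q)%R g <=
    (\esum_(g in ~` K') entropy_term q g +
       (\esum_(g in ~` K') q g) * entropy p) +
    ((\esum_(g in ~` K) p g) * entropy q +
       \esum_(g in ~` K) entropy_term p g).
Proof.
have le1 D : wmass (restrict D p) <= 1 by rewrite -p1 wmass_restrict_le.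
have le1' D : wmass (restrict D q) <= 1 by rewrite -q1 wmass_restrict_le.
apply: (@le_trans _ _ (entropy rest)).
  apply: (@le_trans _ _ (\esum_(g in ~` KK) entropy_term rest g)).
    by apply: le_esum => g /mul_rest h; rewrite /entropy_term h.
  by apply: subset_esum => //; exact: entropy_term_ge0.
apply: le_trans (entropy_weightD rest1) _; apply: leeD.
  apply: le_trans (entropyM_le (le1 _) (le1' _)) _; apply: leeD.
    rewrite -entropy_restrict -[leRHS]mul1e lee_wpmul2r//.
    by apply/entropy_ge0/subprob_weight.
  rewrite -wmass_restrict lee_wpmul2l ?wmass_ge0//.
  by apply: entropy_restrict_le; rewrite p1.
apply: le_trans (entropyM_le (le1 _) _) _; first by rewrite q1.
by rewrite q1 mul1e wmass_restrict entropy_restrict.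
Qed.

End Tail.

(** Both tails are required: an escaping atom of mass near 1 has a small entropy term, and the
    entropy of a product tail involves the masses of the tails of its factors. They are controlled
    only eventually because the masses are known through the limit. *)
Definition tight_cvg (P : nat -> weight R G) p :=
  (forall g, (fun j => fine (P j g)) @ \oo --> fine (p g)) /\
  (forall e : R, (0 < e)%R -> exists2 K : set G, finite_set K &
    \forall j \near \oo, \esum_(g in ~` K) P j g <= e%:E /\
      \esum_(g in ~` K) entropy_term (P j) g <= e%:E).

Lemma tight_cvg1 : tight_cvg (fun=> 1%R) 1%R.
Proof.
split=> [g|e e0]; first exact: cvg_cst.
exists [set 1%g] => //; apply: nearW => j.
have h g : (~` [set 1%g]) g -> (1%R : weight R G) g = 0.
  by move=> /eqP/negbTE /= ->.
rewrite !esum1 ?lee_fin ?ltW// => g /h; rewrite // /entropy_term => ->.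
by rewrite /= mul0r oppr0.
Qed.

(** At most 1 for each point of the finite set [K], and at most 1 for the tail. *)
Lemma tight_cvg_bounded P p : (forall j, wmass (P j) = 1) -> tight_cvg P p ->
  exists2 B : R, (0 <= B)%R & \forall j \near \oo, entropy (P j) <= B%:E.
Proof.
move=> P1 [_ /(_ 1%R ltr01)[K Kfin hK]].
exists ((\sum_(g <- fset_set K) 1) + 1)%R; first by rewrite addr_ge0// sumr_ge0.
apply: filterS hK => j [_ hj].
have Pj1 : wmass (P j) <= 1 by rewrite P1.
rewrite /entropy (esumID K) ?setTI; last by move=> g _; exact: entropy_term_ge0.
rewrite EFinD; apply: leeD => //.
rewrite esum_fset//; last by move=> g _; exact: entropy_term_ge0.
rewrite fsbig_finite//= -sumEFin; apply: lee_sum => g _.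
by rewrite lee_fin; apply: eta_le1; apply: fine_ge0; exact: weight_ge0.
Qed.

Lemma fin_convolution p q g F : finite_set F -> wmass p <= 1 -> wmass q <= 1 ->
  \esum_(h in F) (p h * q (h^-1 * g)%g) =
  (\sum_(h <- fset_set F) fine (p h) * fine (q (h^-1 * g)%g))%:E.
Proof.
move=> Ffin p1 q1; rewrite esum_fset//; last by move=> h _; rewrite mule_ge0 ?weight_ge0.
rewrite fsbig_finite//= -sumEFin; apply: eq_bigr => h _.
by rewrite EFinM !fineK ?weight_fin.
Qed.

Lemma tight_cvgM P p Q q : (forall j, wmass (P j) = 1) -> (forall j, wmass (Q j) = 1) ->
  wmass p = 1 -> wmass q = 1 -> tight_cvg P p -> tight_cvg Q q ->
  tight_cvg (fun j => P j * Q j)%R (p * q)%R.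
Proof.
move=> P1 Q1 p1 q1 cP cQ; split=> [g|e e0]; last first.
  have [B B0 hB] := tight_cvg_bounded P1 cP.
  have [B' B0' hB'] := tight_cvg_bounded Q1 cQ.
  (* The entropy tail of the product is at most [d + d * B + d * B' + d]. *)
  pose d : R := (e / (2 + B + B'))%R.
  have den0 : (0 < 2 + B + B')%R by lra.
  have d0 : (0 < d)%R by rewrite divr_gt0.
  have de : (d * (2 + B + B'))%R = e by rewrite divfK ?gt_eqF.
  have [K Kfin hK] := cP.2 d d0; have [K' Kfin' hK'] := cQ.2 d d0.
  exists [set (k * k')%g | k in K & k' in K']; first exact: finite_image2.
  near=> j.
  have [tP eP] : \esum_(g in ~` K) P j g <= d%:E /\
    \esum_(g in ~` K) entropy_term (P j) g <= d%:E by near: j.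
  have [tQ eQ] : \esum_(g in ~` K') Q j g <= d%:E /\
    \esum_(g in ~` K') entropy_term (Q j) g <= d%:E by near: j.
  have HP : entropy (P j) <= B%:E by near: j.
  have HQ : entropy (Q j) <= B'%:E by near: j.
  have sP := subprob_weight (_ : wmass (P j) <= 1).
  have sQ := subprob_weight (_ : wmass (Q j) <= 1).
  split.
    apply: le_trans (wmass_mul_tail K K' (P1 j) (Q1 j)) _.
    apply: le_trans (leeD tP tQ) _; rewrite -EFinD lee_fin -de; nra.
  apply: le_trans (entropy_mul_tail K K' (P1 j) (Q1 j)) _.
  apply: (@le_trans _ _ ((d%:E + d%:E * B%:E) + (d%:E * B'%:E + d%:E))).
    apply: leeD; apply: leeD => //; apply: lee_pmul => //.
    - by apply: esum_ge0 => g _; exact: weight_ge0.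
    - by apply/entropy_ge0/sP; rewrite P1.
    - by apply: esum_ge0 => g _; exact: weight_ge0.
    - by apply/entropy_ge0/sQ; rewrite Q1.
  by rewrite -!EFinM -!EFinD lee_fin -de; nra.
have le1 (w : weight R G) : wmass w = 1 -> wmass w <= 1 by move=> ->.
have pq1 : wmass (p * q)%R <= 1 by rewrite wmassM p1 q1 mule1.
have PQ1 j : wmass (P j * Q j)%R <= 1 by rewrite wmassM P1 Q1 mule1.
apply/cvgrPdist_le => e e0.
(* One third for truncating the sums of all late [P j * Q j] at [K1], one for truncating the limit
   at [K2], one for the convergence on the finite union [F]. *)
have e3 : (0 < e / 3)%R by rewrite divr_gt0.
have [K1 K1fin hK1] := cP.2 _ e3.
have [_ [K2 [K2fin _] <-] hK2] := ub_ereal_sup_adherent e3 (weight_fin pq1 g).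
pose F := K1 `|` K2.
have Ffin : finite_set F by rewrite finite_setU.
pose S (u v : weight R G) : R :=
  (\sum_(h <- fset_set F) fine (u h) * fine (v (h^-1 * g)%g))%R.
have SE (u v : weight R G) : wmass u = 1 -> wmass v = 1 -> (u * v)%R g =
    (S u v)%:E + \esum_(h in ~` F) (u h * v (h^-1 * g)%g).
  move=> u1 v1; rewrite -fin_convolution ?le1// weightM (esumID F) ?setTI//.
  by move=> h _; rewrite mule_ge0 ?weight_ge0.
have Scvg : (fun j => S (P j) (Q j)) @ \oo --> S p q.
  by apply: cvg_sum_seq => h; apply: cvgM; [exact: cP.1|exact: cQ.1].
have Spq : (S p q <= fine ((p * q)%R g) <= S p q + e / 3)%R.
  have fin := weight_fin pq1 g.
  apply/andP; split.
    rewrite -lee_fin fineK// SE// leeDl//; apply: esum_ge0 => h _.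
    by rewrite mule_ge0 ?weight_ge0.
  rewrite -lerBlDr -lee_fin EFinB fineK//.
  apply: le_trans (ltW hK2) _; rewrite -fin_convolution ?le1//.
  rewrite -[leLHS]esum_fset//; last by move=> h _; rewrite mule_ge0 ?weight_ge0.
  apply: subset_esum; last by move=> h; right.
  by move=> h; rewrite mule_ge0 ?weight_ge0.
have near1 : \forall j \near \oo, (`|S p q - S (P j) (Q j)| <= e / 3)%R.
  by move/cvgrPdist_le: Scvg; exact.
apply: filterS2 hK1 near1 => j [tj _] h2.
have h3 : (S (P j) (Q j) <= fine ((P j * Q j)%R g) <= S (P j) (Q j) + e / 3)%R.
  have fin := weight_fin (PQ1 j) g.
  apply/andP; split; rewrite -lee_fin fineK// SE//.
    by rewrite leeDl//; apply: esum_ge0 => h _; rewrite mule_ge0 ?weight_ge0.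
  rewrite EFinD leeD2l//; apply: le_trans tj.
  apply: (@le_trans _ _ (\esum_(h in ~` F) P j h)).
    apply: le_esum => h _; rewrite -[leRHS]mule1 lee_wpmul2l ?weight_ge0//.
    by have /andP[] := subprob01 (subprob_weight (le1 _ (Q1 j))) (h^-1 * g)%g.
  apply: subset_esum; first exact: weight_ge0.
  by move=> h hF hK; apply: hF; left.
move: h2; rewrite !ler_norml => /andP[h21 h22].
by have /andP[? ?] := Spq; have /andP[? ?] := h3; apply/andP; split; lra.
Unshelve. all: by end_near.
Qed.

Lemma tight_cvgX P p n : (forall j, wmass (P j) = 1) -> wmass p = 1 ->
  tight_cvg P p -> tight_cvg (fun j => P j ^+ n)%R (p ^+ n)%R.
Proof.
move=> P1 p1 cP; elim: n => [|n ih].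
  by rewrite expr0; under eq_fun do rewrite expr0; exact: tight_cvg1.
rewrite exprS; under eq_fun do rewrite exprS.
by apply: tight_cvgM => // [j|]; rewrite wmassX1.
Qed.

Lemma entropy_tight_cvg P p (e : R) : (forall j, wmass (P j) = 1) -> wmass p = 1 ->
  tight_cvg P p -> (0 < e)%R ->
  \forall j \near \oo, entropy (P j) <= entropy p + e%:E.
Proof.
move=> P1 p1 [cP tP] e0; have e2 : (0 < e / 2)%R by rewrite divr_gt0.
have [K Kfin hK] := tP _ e2.
have P0 j h : (0 <= fine (P j h))%R by apply: fine_ge0; exact: weight_ge0.
have p0 h : (0 <= fine (p h))%R by apply: fine_ge0; exact: weight_ge0.
have := sum_eta_cvg_le (fset_set K) P0 p0 cP e2.
apply: filterS2 hK => j [_ tj] sj.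
have HK (w : weight R G) : wmass w = 1 ->
    \esum_(g in K) entropy_term w g = (\sum_(g <- fset_set K) eta (fine (w g)))%:E.
  move=> w1; rewrite esum_fset//; last by move=> g _; apply: entropy_term_ge0; rewrite w1.
  by rewrite fsbig_finite//= -sumEFin.
rewrite /entropy (esumID K) ?setTI; last by move=> g _; apply: entropy_term_ge0; rewrite P1.
rewrite HK//; apply: (@le_trans _ _
  ((\sum_(h <- fset_set K) eta (fine (p h)) + e / 2)%:E + (e / 2)%:E)).
  by apply: leeD; rewrite ?lee_fin.
rewrite -EFinD -addrA -splitr EFinD -HK//; apply: leeD2r.
by apply: subset_esum => // g; apply: entropy_term_ge0; rewrite p1.
Qed.

End WeightLimits.

Section WeakLimits.
Context {R : realType} {m : nat} {A : automaton m}.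
Local Notation G := (autgroup A).
Implicit Types (mu nu : probability G R) (P : nat -> probability G R).

Lemma weak_cvg_law P nu : weak_cvg P nu ->
  forall g, (fun j => fine (law (P j) g)) @ \oo --> fine (law nu g).
Proof.
move=> cv g.
have intE (mu : probability G R) : \int[mu]_x (\1_[set g] x) = fine (law mu g).
  by rewrite /Rintegral integral_indic// setIT.
(* In the discrete topology the indicator of a point is a continuous bounded test function. *)
have := cv (\1_[set g] : G -> R).
rewrite intE (_ : (fun n => \int[P n]_x \1_[set g] x) =
  fun j => fine (law (P j) g)); last by apply/funext => j; exact: intE.
apply.
  move=> x U /nbhs_singleton Ux.
  have xU : [set x] `<=` (\1_[set g] : discrete_topology G -> R) @^-1` U by move=> y ->.
  exact: (filterS xU (@discrete_set1 (discrete_topology G) x)).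
by exists 1 => x; rewrite indicE; case: (_ \in _); rewrite ?normr0 ?normr1.
Qed.

Lemma weight_concentrated (p : weight R G) (e : R) : wmass p = 1%E -> 0 < e ->
  exists2 K : set G, finite_set K & 1 - e < \sum_(g <- fset_set K) fine (p g).
Proof.
move=> p1 e0; have pfin : \esum_(g in [set: G]) p g \is a fin_num.
  by rewrite -/(wmass p) p1.
have [_ [K [Kfin _] <-] hK] := ub_ereal_sup_adherent e0 pfin.
exists K => //; move: hK; rewrite -[ereal_sup _]/(wmass p) p1 fsbig_finite// => hK.
rewrite -lte_fin -sumEFin (eq_bigr p); first exact: hK.
by move=> g _; apply: fineK; apply: weight_fin; rewrite p1.
Qed.

(** The limit is a probability, so a finite set [K'] carries more than [1 - e / 2] of it, hence
    eventually as much of the laws; the entropy tails come from entropy-tightness. *)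
Lemma tight_weak_cvg P nu : entropy_tight P -> weak_cvg P nu ->
  tight_cvg (fun j => law (P j)) (law nu).
Proof.
move=> tight /weak_cvg_law cv; split=> // e e0.
have [K Kfin hK] := tight e e0.
have [K' Kfin' hK'] := weight_concentrated (wmass_law nu) (divr_gt0 e0 (ltr0n R 2)).
have Ufin : finite_set (K `|` K') by rewrite finite_setU.
exists (K `|` K') => //.
have sub_esum B (a : G -> \bar R) : (forall g, 0 <= a g)%E -> B `<=` K `|` K' ->
    (\esum_(g in ~` (K `|` K')) a g <= \esum_(g in ~` B) a g)%E.
  by move=> a0 BK; apply: subset_esum => // g gK gB; apply/gK/BK.
have := cvgr_gt _ (@cvg_sum_seq _ _ (fset_set K') _ _ cv) _ hK' => /(_ _) near1.
apply: filterS near1 => j hj; split; last first.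
  apply: le_trans (sub_esum K _ _ _) (ltW (hK j)); last exact: subsetUl.
  by apply: (@entropy_term_ge0 _ _ (law (P j))); rewrite wmass_law.
apply: le_trans (sub_esum K' _ _ _) _; [exact: weight_ge0|exact: subsetUr|].
have := wmass_law (P j); rewrite /wmass (esumID K') ?setTI; last first.
  by move=> g _; exact: weight_ge0.
rewrite (_ : \esum_(g in K') _ = (\sum_(g <- fset_set K') fine (law (P j) g))%:E).
  set t := (\esum_(g in ~` K') _)%E; move=> tE.
  have t0 : (0 <= t)%E by apply: esum_ge0 => g _; exact: weight_ge0.
  clearbody t; case: t t0 tE => [t t0 [] tE|_ //|//].
  by rewrite lee_fin; lra.
rewrite esum_fset// fsbig_finite// -sumEFin; apply: eq_bigr => g _.
by rewrite fineK// weight_fin ?wmass_law.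
Qed.

Lemma entropy_tight_lty (I : Type) (P : I -> probability G R) i :
  entropy_tight P -> (entropy (law (P i)) < +oo)%E.
Proof.
move=> /(_ 1 ltr01)[K Kfin hK].
have P1 : (wmass (law (P i)) <= 1)%E by rewrite wmass_law.
rewrite /entropy (esumID K) ?setTI; last by move=> g _; exact: entropy_term_ge0.
rewrite lte_add_pinfty//; last exact: lt_trans (hK i) (ltry _).
rewrite esum_fset//; last by move=> g _; exact: entropy_term_ge0.
by rewrite fsbig_finite//= sumEFin ltry.
Qed.

(** By [entropy_leM], every positive convolution power has infinite entropy. *)
Lemma asymptotic_entropy_pinfty (p : weight R G) : wmass p = 1%E ->
  entropy p = +oo%E -> asymptotic_entropy p = +oo%E.
Proof.
move=> p1 Hp; rewrite /asymptotic_entropy; apply: lim_near_cst => //.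
exists 1%N => // -[//|n] _; rewrite convolution_powerE.
have -> : entropy (p ^+ n.+1) = +oo%E.
  apply/eqP; rewrite -leye_eq -Hp exprS; apply: entropy_leM; first by rewrite p1.
  by rewrite wmassX1.
by rewrite gt0_muley// lte_fin invr_gt0.
Qed.

End WeakLimits.

Theorem theorem5 (R : realType) (m : nat) (hm : (2 <= m)%N) (A : automaton m)
  (mu : probability (autgroup A) R)
  (htrans : level_transitive (generated (supp mu)))
  (Tmu : nat -> probability (autgroup A) R)
  (hT0 : Tmu 0%N = mu)
  (hTS : forall k, is_ascension (Ordinal (ltnW hm)) (Tmu k) (Tmu k.+1))
  (htight : entropy_tight Tmu)
  (nu : probability (autgroup A) R)
  (hnu : subsequential_weak_limit Tmu nu) :
  (asymptotic_entropy (mass mu) <= asymptotic_entropy (mass nu))%E.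
Proof.
rewrite -[mass mu]/(law mu : _ -> _) -[mass nu]/(law nu : _ -> _).
have T1 k : wmass (law (Tmu k)) = 1%E by exact: wmass_law.
have nu1 : wmass (law nu) = 1%E by exact: wmass_law.
have Hfin k : (entropy (law (Tmu k)) < +oo)%E by exact: entropy_tight_lty.
have trans k : level_transitive (generated (supp (Tmu k))).
  elim: k => [|k ih]; first by rewrite hT0.
  exact: level_transitive_ascension (hTS k) ih.
have mono k : (asymptotic_entropy (law mu) <= asymptotic_entropy (law (Tmu k)))%E.
  elim: k => [|k ih]; first by rewrite hT0.
  by apply: le_trans ih _; apply: asymptotic_entropy_ascension (hTS k) _ _ _.
have [Hnu|Hnu] := eqVneq (entropy (law nu)) +oo%E.
  by rewrite (asymptotic_entropy_pinfty nu1 Hnu) leey.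
have {}Hnu : (entropy (law nu) < +oo)%E by rewrite ltey.
have [phi _ cvnu] := hnu.
have tight_phi : entropy_tight (Tmu \o phi).
  by move=> e /htight[K Kfin hK]; exists K => // i; exact: hK.
have cv := tight_weak_cvg tight_phi cvnu.
have Hmu : (entropy (law mu) < +oo)%E by rewrite -hT0.
have [lmu [muE _ _]] := asymptotic_entropyP (wmass_law mu) Hmu.
have [lnu [-> _ lnuP]] := asymptotic_entropyP nu1 Hnu.
(* For a fixed [r] one late index of the subsequence suffices: its law bounds [lmu] at the power
   [r], and upper semicontinuity compares that power with the power of [nu] up to [e]. *)
have le_pow r : ((r%:R * lmu)%:E <= entropy (law nu ^+ r)%R)%E.
  apply/lee_addgt0Pr => e e0.
  have [N _ hN] := entropy_tight_cvg (fun j => wmassX1 r (T1 (phi j)))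
    (wmassX1 r nu1) (tight_cvgX r (fun j => T1 (phi j)) nu1 cv) e0.
  apply: le_trans (hN N (leqnn N)).
  have [l [lE ln _]] := asymptotic_entropyP (T1 (phi N)) (Hfin (phi N)).
  apply: le_trans (ln r); rewrite lee_fin ler_wpM2l// -lee_fin -lE -muE.
  exact: mono.
rewrite muE lee_fin; apply/ler_addgt0Pr => e e0.
have [N hN] := lnuP e e0.
apply: (@slope_le _ _ _ 0 N) => r /hN; rewrite add0r -lee_fin.
exact: le_trans (le_pow r).
Qed.
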